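(* Let $\widehat\pi=\{\pi_t\}_{t=1}^T$ be the (random) policy sequence generated by the algorithm SubMAPL with constant step size $\eta>0$ in the open multi-agent Markov decision process described in the context. Assume: (1) for every $t\in[T]$ and every state $s\in\mathcal S$, the set function $F_t(\cdot;s):2^{\Omega_t}\to\mathbb R_{\ge 0}$ is normalized, monotone and submodular, and $\mathcal A_i\neq\emptyset$ for all $i\in\mathcal N_t$; (2) there is a constant $B<\infty$ such that $0\le F_t(e\mid A;s)\le B$ for all $t\in[T]$, all $s\in\mathcal S$, all $A\subseteq\Omega_t$ and all $e\in\Omega_t\setminus A$. Then $$\frac12 J^\star-J(\widehat\pi)\ \le\ \mathcal C_T+\frac12\Delta_T,$$ where $$\mathcal C_T=\frac{\mathbb E_{s_1\sim\mu_1}\big[D_{\mathrm{KL},1}(\pi_1^\star\Vert\pi_1)\big]+\mathcal V_T^{\mathrm{open}}}{2\eta}+\frac{\eta\,T\,N_{\max}B^2}{4},\qquad \Delta_T=\Big[J^\star-\mathbb E_{\tau\sim p^{\widehat\pi}}\Big[\sum_{t=1}^T F_t^\star(s_t)\Big]\Big]_+ .$$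
   Context: Open multi-agent MDP. $T\in\mathbb N$, $[T]=\{1,\dots,T\}$. $(\mathcal N_t)_{t\in[T]}$ is an exogenously given sequence of finite sets of active agents (not influenced by the policies or the state transitions), $\mathcal N_0=\emptyset$, $N_{\max}=\max_{t}|\mathcal N_t|$. Each agent $i$ has a finite action set $\mathcal A_i$ and a finite observation space $\mathcal O_i$. $\mathcal S$ is the state space, $\mu_1$ the initial distribution on $\mathcal S$, $O_{i,t}:\mathcal S\to\mathcal O_i$ deterministic observation maps with $o_{i,t}=O_{i,t}(s_t)$, and $P_t(\cdot\mid s,\mathbf a)$ transition kernels, $s_{t+1}\sim P_t(\cdot\mid s_t,\mathbf a_t)$, $\mathbf a_t=(a_{i,t})_{i\in\mathcal N_t}$. (All functions of the state are assumed measurable where needed.) Put $\Omega_t=\{(i,a):i\in\mathcal N_t,a\in\mathcal A_i\}$, $\Omega_{i,t}=\{(i,a):a\in\mathcal A_i\}$, $\mathcal I_t=\{A\subseteq\Omega_t:|A\cap\Omega_{i,t}|\le1\ \forall i\in\mathcal N_t\}$. The executed set is $A_t=\{(i,a_{i,t}):i\in\mathcal N_t\}\in\mathcal I_t$. $F_t(\cdot;s):2^{\Omega_t}\to\mathbb R_{\ge0}$ is the stage utility, with marginal gain $F_t(e\mid A;s)=F_t(A\cup\{e\};s)-F_t(A;s)$. A set function $F$ is normalized if $F(\emptyset)=0$, monotone if $A\subseteq A'\Rightarrow F(A)\le F(A')$, submodular if $F(e\mid A)\ge F(e\mid A')$ for $A\subseteq A'$, $e\notin A'$. $[z]_+=\max\{z,0\}$.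 Objective. A local policy $\pi^i$ assigns to each $o\in\mathcal O_i$ a probability distribution $\pi^i(\cdot\mid o)$ on $\mathcal A_i$; given local policies, the decentralized factorized policy sequence is $\pi=\{\pi_t\}_{t=1}^T$, $\pi_t(\mathbf a_t\mid\mathbf o_t)=\prod_{i\in\mathcal N_t}\pi^i(a_{i,t}\mid o_{i,t})$ (actions sampled independently across agents). $p^\pi$ is the induced law of $\tau=(s_1,\mathbf a_1,\dots,s_T,\mathbf a_T,s_{T+1})$, $J(\pi)=\mathbb E_{\tau\sim p^\pi}[\sum_{t=1}^TF_t(A_t;s_t)]$, and $J^\star=\max_\pi J(\pi)$ over such policy sequences. Similarly $J(\widehat\pi)=\mathbb E_{\tau\sim p^{\widehat\pi}}[\sum_{t=1}^T F_t(A_t;s_t)]$, where $p^{\widehat\pi}$ is the law of the process generated by SubMAPL below. SubMAPL. Each active agent $i$ keeps logits $\theta^i(o,a)\in\mathbb R$, $o\in\mathcal O_i$, $a\in\mathcal A_i$; its policy is $\pi^i(a\mid o)=e^{\theta^i(o,a)}/\sum_{b\in\mathcal A_i}e^{\theta^i(o,b)}$. Initially (agents in $\mathcal N_1$) the logits are given finite values $\theta^{i,0}$. At time $t$, with current policy $\pi_t$ (local policies $\pi^i$, $i\in\mathcal N_t$): every $i\in\mathcal N_t$ observes $o_{i,t}$ and independently samples $a_{i,t}\sim\pi^i(\cdot\mid o_{i,t})$; set $A_t^{-i}=A_t\setminus\{(i,a_{i,t})\}$ and $\widehat g_{i,a,t}=F_t((i,a)\mid A_t^{-i};s_t)$ for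 all $a\in\mathcal A_i$; the logits are updated by $\theta^{i,+}(o_{i,t},a)=\theta^i(o_{i,t},a)+\eta\widehat g_{i,a,t}$, all other entries unchanged, giving the post-update policy $\pi_t^+$ (local policies $\pi^{i,+}$); then $s_{t+1}\sim P_t(\cdot\mid s_t,\mathbf a_t)$. Migration: $\pi_{t+1}$ has local policies $\pi^{i,+}$ for $i\in\mathcal N_{t+1}\cap\mathcal N_t$ and $\pi^{i,0}$ (softmax of given finite logits $\theta^{i,0}$) for $i\in\mathcal N_{t+1}\setminus\mathcal N_t$; departing agents are dropped. Stagewise comparator. $\mathcal F_t=\{x\in[0,1]^{\Omega_t}:\sum_{a\in\mathcal A_i}x_{(i,a)}=1\ \forall i\in\mathcal N_t\}$. For $x\in\mathcal F_t$, $\tilde f_t(x;s)=\mathbb E[F_t(A;s)]$ where $A$ contains exactly one element of each $\Omega_{i,t}$, equal to $(i,a)$ with probability $x_{(i,a)}$, independently over $i\in\mathcal N_t$. $F_t^\star(s)=\max_{A\in\mathcal I_t}F_t(A;s)$. $x_t^\star\in\arg\max_{x\in\mathcal F_t}\tilde f_t(x;s_t)$ is a (measurable) selection determined by $t$ and $s_t$. $\pi_t^\star$ is the tabular policy with $(\pi_t^\star)^i(a\mid o_{i,t})=x^\star_{(i,a),t}$ and $(\pi_t^\star)^i(\cdot\mid o)=\pi^i(\cdot\mid o)$ (the local policy of $\pi_t$) for $o\ne o_{i,t}$. KL quantities. $D_{\mathrm{KL}}(p\Vert q)=\sum_a p_a\log(p_a/q_a)$ with $0\log(0/q)=0$; for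 tabular policies $\pi,\pi'$ on $\mathcal N_t$, $D_{\mathrm{KL},t}(\pi\Vert\pi')=\sum_{i\in\mathcal N_t}\sum_{o\in\mathcal O_i}D_{\mathrm{KL}}(\pi^i(\cdot\mid o)\Vert\pi'^i(\cdot\mid o))$. The open-system KL tracking variation is $$\mathcal V_T^{\mathrm{open}}=\mathbb E_{\tau\sim p^{\widehat\pi}}\Big[\sum_{t=1}^{T-1}\big[D_{\mathrm{KL},t+1}(\pi_{t+1}^\star\Vert\pi_{t+1})-D_{\mathrm{KL},t}(\pi_t^\star\Vert\pi_t^+)\big]_+\Big].$$ *)

(* Defs.v *)
From HB Require Import structures.
From mathcomp Require Import all_boot all_order all_algebra finmap.
From mathcomp Require Import all_classical all_reals all_analysis.
From mathcomp Require Import measurable_realfun.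

Set Implicit Arguments.
Unset Strict Implicit.
Unset Printing Implicit Defensive.

Import Order.TTheory GRing.Theory Num.Theory.
Import numFieldNormedType.Exports.

Local Open Scope classical_set_scope.
Local Open Scope ring_scope.

Section SetFunctions.
Variables (R : realType) (E : finType).
Implicit Types (f : {set E} -> R) (A : {set E}).

Definition gain f A (e : E) : R := f (e |: A)%SET - f A.

Definition set_normalized f : Prop := f finset.set0 = 0.

Definition set_monotone f : Prop :=
  forall A A' : {set E}, A \subset A' -> f A <= f A'.

Definition set_submodular f : Prop :=
  forall (A A' : {set E}) (e : E),
    A \subset A' -> e \notin A' -> gain f A' e <= gain f A e.

End SetFunctions.

(* The convention 0 log (0 / q) = 0 holds by absorption.  The value is only
   meaningful when [p] vanishes wherever [q] does; it is only used with softmax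
   policies for [q], which are positive everywhere. *)
Definition KL (R : realType) (A : finType) (p q : A -> R) : R :=
  \sum_a p a * ln (p a / q a).

(* Agents live in an arbitrary universe [I].  Stages are numbered 1, ..., T,
   and time-indexed data at other times play no role for the horizon T.
   Nonemptiness of the action sets is part of the structure because
   measurable types, here the joint actions, are inhabited. *)
Record open_system (I : choiceType) := OpenSystem {
  active : nat -> {fset I};
  act : I -> finType;
  obs : I -> finType;
  act_inhabited : forall t (i : active t), (0 < #|act (val i)|)%N
}.

Section Agents.
Variables (R : realType) (I : choiceType) (G : open_system I).

(* The ground set of stage [t]: the pairs (i, b) with i active and b an action
   of i. *)
Definition slot (t : nat) : finType := {i : active G t & act G (val i)}.

Definition mkslot t (i : active G t) (b : act G (val i)) : slot t :=
  Tagged (fun j : active G t => act G (val j)) b.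

Definition independent t : {set {set slot t}} :=
  [set A : {set slot t} |
    [forall i : active G t, #|[set e in A | tag e == i]| <= 1]%N]%SET.

Definition jact (t : nat) := {dffun forall i : active G t, act G (val i)}.

Lemma jact_witness t : jact t.
Proof.
apply: finfun => i; have := @act_inhabited _ G t i.
by case: (pickP (mem (act G (val i)))) => [b _ _|/eq_card0 ->].
Qed.

HB.instance Definition _ t := Finite.on (jact t).
HB.instance Definition _ t := isPointed.Build (jact t) (jact_witness t).
HB.instance Definition _ t := @isMeasurable.Build default_measure_display
  (jact t) (@discrete_measurable (jact t)) (@discrete_measurable0 _)
  (@discrete_measurableC _) (@discrete_measurableU _).

Definition executed t (a : jact t) : {set slot t} :=
  [set mkslot (a i) | i : active G t]%SET.

(* Tables indexed by an active agent, an observation and an action: both the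
   local policies and the logits in force at stage [t]. *)
Definition tabular (t : nat) : Type :=
  forall i : active G t, obs G (val i) -> act G (val i) -> R.

Definition is_policy t (p : tabular t) : Prop :=
  forall i o, (forall b, 0 <= p i o b) /\ \sum_b p i o b = 1.

Definition KLtab t (p q : tabular t) : R :=
  \sum_(i : active G t) \sum_(o : obs G (val i)) KL (p i o) (q i o).

Definition softmax t (theta : tabular t) : tabular t :=
  fun i o b => expR (theta i o b) / \sum_c expR (theta i o c).

(* A family of local policies, one per agent and not depending on time; only
   agents that are active at some time are constrained. *)
Record local_policies := LocalPolicies {
  local_policy :> forall i : I, obs G i -> act G i -> R;
  local_policyP : forall t,
    is_policy (fun i : active G t => @local_policy (val i))
}.

Definition Nmax (T : nat) : nat := \max_(1 <= t < T.+1) #|` active G t|.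

Lemma softmaxP t (theta : tabular t) : is_policy (softmax theta).
Proof.
move=> i o; split=> [b|].
  by rewrite divr_ge0 ?expR_ge0// sumr_ge0// => c _; rewrite expR_ge0.
rewrite -mulr_suml divff// gt_eqF//.
have /card_gt0P[b _] := act_inhabited i.
rewrite (bigD1 b)//= ltr_pwDl ?expR_gt0//.
by apply: sumr_ge0 => c _; exact: expR_ge0.
Qed.

Lemma sum_jact_prod t (F : forall i : active G t, act G (val i) -> R) :
  \sum_(a : jact t) \prod_i F i (a i) = \prod_i \sum_b F i b.
Proof.
rewrite (reindex (@dffun_of_fprod _ _)); last exact/onW_bij/dffun_of_fprod_bij.
pose P (i : active G t) : {ffun act G (val i) -> R} := [ffun b => F i b].
transitivity (\sum_(g : fprod (fun i : active G t => act G (val i)))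
    \prod_i P i (g i)).
  by apply: eq_bigr => g _; apply: eq_bigr => i _; rewrite !ffunE.
rewrite (big_fprod _ _ P) -(bigA_distr_big_dep (fun i => tagged_with _ i)
  (fun i x => untag 0 (P i) x)).
apply: eq_bigr => i _; rewrite -(big_tag (fun i => P i)).
by apply: eq_bigr => b _; rewrite ffunE.
Qed.

End Agents.
Arguments softmax {R I G t} theta i o b.
Arguments independent {I G} t.
Arguments tabular R {I} G t.
Arguments local_policies R {I} G.
Arguments Nmax {I} G T.

Record open_mdp (R : realType) (I : choiceType) (G : open_system I)
    (d : measure_display) (S : measurableType d) := OpenMDP {
  init : probability S R;
  observe : forall t (i : active G t), S -> obs G (val i);
  trans : forall t, jact G t -> R.-pker S ~> S;
  util : forall t, S -> {set slot G t} -> R;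
  util_ge0 : forall t s A, 0 <= @util t s A;
  measurable_observe : forall t (i : active G t) o,
    measurable (@observe t i @^-1` [set o]);
  measurable_util : forall t A, measurable_fun setT (@util t ^~ A)
}.
Arguments observe {R I G d S} M {t} i s : rename.
Arguments trans {R I G d S} M {t} a : rename.
Arguments util {R I G d S} M t s A : rename.

Section Process.
Variables (R : realType) (I : choiceType) (G : open_system I).
Variables (d : measure_display) (S : measurableType d) (M : open_mdp R G S).

Fixpoint hist_display (n : nat) : measure_display :=
  if n is m.+1 then
    measure_prod_display
      (hist_display m, measure_prod_display (default_measure_display, d))
  else d.

(* [hist n] is the space of the trajectories (s_1, a_1, ..., s_n, a_n, s_{n+1}),
   bracketed as (((s_1, (a_1, s_2)), (a_2, s_3)), ...); the history before the
   decision of stage n+1 is thus an element of [hist n]. *)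
Fixpoint hist (n : nat) : measurableType (hist_display n) :=
  match n return measurableType (hist_display n) with
  | 0 => S
  | m.+1 => (hist m * (jact G m.+1 * S))%type
  end.

Definition state n : hist n -> S :=
  match n return hist n -> S with
  | 0 => fun h => h
  | m.+1 => fun h => h.2.2
  end.

(* For [f] depending on the history [h] before stage k+1, the joint action of
   that stage and the next state, [at_stage f t tau] is the value of [f] at
   stage [t] (k = t - 1) along the trajectory [tau], for 1 <= t <= n. *)
Fixpoint at_stage (f : forall k, hist k -> jact G k.+1 -> S -> R) (t n : nat) :
    hist n -> R :=
  match n return hist n -> R with
  | 0 => fun=> 0
  | m.+1 => fun tau => if t == m.+1 then f m tau.1 tau.2.1 tau.2.2
                       else at_stage f t tau.1
  end.

(* Probability that the joint action [a] is drawn when the agents sample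
   independently from the local policies [p] given their observations of [s]. *)
Definition joint_prob t (p : tabular R G t) (s : S) (a : jact G t) : R :=
  \prod_(i : active G t) p i (observe M i s) (a i).

(* A possibly history-dependent sequence of decentralized policies. *)
Record policy_seq := PolicySeq {
  pol : forall n, hist n -> tabular R G n.+1;
  polP : forall n (h : hist n), is_policy (@pol n h);
  measurable_pol : forall n i o b,
    measurable_fun setT (fun h : hist n => @pol n h i o b)
}.

Arguments pol pi {n} h i o b : rename.

Section Law.
Variable pi : policy_seq.

Definition extend_law n (mu : set (hist n) -> \bar R) :
    set (hist n.+1) -> \bar R :=
  fun C => (\int[mu]_h \sum_(a : jact G n.+1)
    (joint_prob (pol pi h) (state h) a)%:E *
      trans M a (state h) [set s | C (h, (a, s))])%E.

Lemma measurable_state n : measurable_fun setT (@state n).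
Proof.
case: n => [|n] //=.
exact: (measurableT_comp measurable_snd measurable_snd).
Qed.

Lemma measurable_fun_fin d' (X : measurableType d') (T : finType)
    (f : T -> X -> R) (g : X -> T) :
  (forall y, measurable_fun setT (f y)) ->
  (forall y, measurable (g @^-1` [set y])) ->
  measurable_fun setT (fun x => f (g x) x).
Proof.
move=> mf mg.
rewrite (_ : (fun x => _) = (fun x => \sum_y
    \1_(g @^-1` [set y]) x * f y x)); last first.
  apply/funext => x; rewrite (bigD1 (g x))//= big1 ?addr0.
    by rewrite indicE mem_set// mul1r.
  move=> y /negP ne; rewrite indicE memNset ?mul0r//= => eqy.
  by apply: ne; rewrite -eqy.
apply: measurable_sum => y; apply: measurable_funM => //.
Qed.

Lemma measurable_observed d' (X : measurableType d') t (i : active G t)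
    (f : obs G (val i) -> X -> R) (g : X -> S) :
  (forall o, measurable_fun setT (f o)) -> measurable_fun setT g ->
  measurable_fun setT (fun x => f (observe M i (g x)) x).
Proof.
move=> mf mg; apply: (measurable_fun_fin (g := observe M i \o g)) => // o.
rewrite comp_preimage -[X in measurable X]setTI.
by apply: mg => //; exact: measurable_observe.
Qed.

Lemma measurable_joint_prob n (a : jact G n.+1) :
  measurable_fun setT (fun h : hist n => joint_prob (pol pi h) (state h) a).
Proof.
apply: measurable_prod => i _.
apply: (measurable_observed (f := fun o h => pol pi h i o (a i))).
  by move=> o; exact: measurable_pol.
exact: measurable_state.
Qed.

Lemma joint_prob_ge0 n (h : hist n) a : 0 <= joint_prob (pol pi h) (state h) a.
Proof. by apply: prodr_ge0 => i _; have [] := @polP pi _ h i (observe M i (state h)). Qed.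

Lemma sum_joint_prob n (h : hist n) :
  \sum_a joint_prob (pol pi h) (state h) a = 1.
Proof.
rewrite /joint_prob.
rewrite (sum_jact_prod (fun i b => pol pi h i (observe M i (state h)) b)).
by apply: big1 => i _; have [] := @polP pi _ h i (observe M i (state h)).
Qed.

Lemma measurable_slice n (C : set (hist n.+1)) (h : hist n) (a : jact G n.+1) :
  measurable C -> measurable [set s | C (h, (a, s))].
Proof.
move=> mC; rewrite -[X in measurable X]setTI.
have mf : measurable_fun setT (fun s : S => (h, (a, s))).
  apply: measurable_fun_pair; first exact: measurable_cst.
  by apply: measurable_fun_pair; [exact: measurable_cst|exact: measurable_id].
exact: mf.
Qed.

Section TransKernel.
Variables (n : nat) (a : jact G n.+1).

Let k (h : hist n) : {measure set S -> \bar R} := trans M a (state h).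

Let measurable_k U : measurable U -> measurable_fun setT (k ^~ U).
Proof.
move=> mU; have mt := measurable_kernel (trans M a) U mU.
exact: (measurableT_comp mt (@measurable_state n)).
Qed.

HB.instance Definition _ := isKernel.Build _ _ _ _ R k measurable_k.

Let k1 h : k h setT = 1%E.
Proof. exact: prob_kernel. Qed.

HB.instance Definition _ := Kernel_isProbability.Build _ _ _ _ R k k1.

Lemma measurable_trans_slice (C : set (hist n.+1)) : measurable C ->
  measurable_fun setT
    (fun h : hist n => trans M a (state h) [set s | C (h, (a, s))]).
Proof.
move=> mC; pose D := [set x : hist n * S | C (x.1, (a, x.2))].
have mD : measurable D.
  rewrite -[X in measurable X]setTI.
  have mf : measurable_fun setT (fun x : hist n * S => (x.1, (a, x.2))).
    apply: measurable_fun_pair; first exact: measurable_fst.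
    by apply: measurable_fun_pair; [exact: measurable_cst|exact: measurable_snd].
  exact: mf.
rewrite (_ : (fun h => _) = (fun h => k h (xsection D h))).
  by apply: measurable_fun_xsection_finite_kernel; rewrite inE.
by apply/funext => h; rewrite xsectionE.
Qed.

End TransKernel.

Section ExtendLaw.
Variables (n : nat) (mu : probability (hist n) R).

Let extend_law0 : extend_law mu set0 = 0%E.
Proof.
rewrite /extend_law integral0_eq// => h _.
by rewrite big1// => a _; rewrite measure0 mule0.
Qed.

Let extend_law_ge0 C : (0 <= extend_law mu C)%E.
Proof.
apply: integral_ge0 => h _; apply: sume_ge0 => a _.
by rewrite mule_ge0// lee_fin joint_prob_ge0.
Qed.

Let extend_law_sigma_additive : semi_sigma_additive (extend_law mu).
Proof.
move=> F mF tF mUF.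
pose t (h : hist n) (a : jact G n.+1) (C : set (hist n.+1)) : \bar R :=
  trans M a (state h) [set s | C (h, (a, s))].
have tU h a : t h a (\bigcup_i F i) = (\sum_(i <oo) t h a (F i))%E.
  apply/esym/cvg_lim => //; rewrite /t.
  rewrite [X in trans M a _ X](_ : _ = \bigcup_i [set s | F i (h, (a, s))]).
    apply: measure_semi_sigma_additive.
    - by move=> i; exact: measurable_slice.
    - apply/trivIsetP => i j _ _ ij; rewrite -subset0 => s [Fi Fj].
      move/trivIsetP : tF => /(_ i j Logic.I Logic.I ij)/seteqP[+ _].
      by move=> /(_ (h, (a, s))); apply.
    - by apply: bigcup_measurable => i _; exact: measurable_slice.
  by [].
have t0 h a C : (0 <= (joint_prob (pol pi h) (state h) a)%:E * t h a C)%E.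
  by rewrite mule_ge0// lee_fin joint_prob_ge0.
have -> : extend_law mu (\bigcup_i F i) = (\sum_(i <oo) extend_law mu (F i))%E.
  rewrite /extend_law -integral_nneseries//.
  - apply: eq_integral => h _; rewrite nneseries_sum; last by move=> a j _; exact: t0.
    apply: eq_bigr => a _; rewrite nneseriesZl//.
    by congr (_ * _)%E; exact: tU.
  - move=> i; apply: emeasurable_sum => a; apply: emeasurable_funM.
      by apply/measurable_EFinP; exact: measurable_joint_prob.
    exact: measurable_trans_slice.
  - by move=> i h _; apply: sume_ge0 => a _; exact: t0.
by apply: is_cvg_nneseries => i _ _; exact: extend_law_ge0.
Qed.

HB.instance Definition _ := isMeasure.Build _ _ R (extend_law mu)
  extend_law0 extend_law_ge0 extend_law_sigma_additive.

Let extend_lawT : extend_law mu setT = 1%E.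
Proof.
rewrite /extend_law (eq_integral (cst 1%E)).
  by rewrite integral_cst// mul1e; exact: probability_setT.
move=> h _; rewrite (eq_bigr (fun a => (joint_prob (pol pi h) (state h) a)%:E)).
  by rewrite sumEFin sum_joint_prob.
by move=> a _; rewrite prob_kernel mule1.
Qed.

HB.instance Definition _ :=
  Measure_isProbability.Build _ _ R (extend_law mu) extend_lawT.

End ExtendLaw.

Fixpoint law (n : nat) : probability (hist n) R :=
  match n return probability (hist n) R with
  | 0 => init M
  | m.+1 => extend_law (law m)
  end.

End Law.

Definition reward k (h : hist k) (a : jact G k.+1) (_ : S) : R :=
  util M k.+1 (state h) (executed a).

Definition J (T : nat) (pi : policy_seq) : R :=
  fine 'E_(law pi T)[fun tau => \sum_(1 <= t < T.+1) at_stage reward t tau].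

Lemma measurable_local (p : local_policies R G) n (i : active G n.+1) o b :
  measurable_fun setT (fun _ : hist n => p (val i) o b).
Proof. exact: measurable_cst. Qed.

Definition factorized (p : local_policies R G) : policy_seq :=
  @PolicySeq (fun n _ i => p (val i))
    (fun n _ => @local_policyP _ _ _ p n.+1) (@measurable_local p).

(* The maximum of J over the factorized policies; written as a supremum, it is
   meaningful without first showing that the maximum is attained. *)
Definition Jstar (T : nat) : R :=
  sup (range (fun p : local_policies R G => J T (factorized p))).

(* The empty set is independent, so the starting value does not affect the
   maximum. *)
Definition Fstar t (s : S) : R :=
  \big[Num.max/util M t s finset.set0]_(A in independent t) util M t s A.

Definition feasible t (x : slot G t -> R) : Prop :=
  (forall e, 0 <= x e <= 1) /\
  (forall i : active G t, \sum_b x (mkslot (i := i) b) = 1).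

(* Expected utility of a random set with one action per active agent, drawn
   independently across agents with marginals [x]. *)
Definition extension t (s : S) (x : slot G t -> R) : R :=
  \sum_(a : jact G t)
    (\prod_(i : active G t) x (mkslot (a i))) * util M t s (executed a).

Definition stage_maximizer t (s : S) (x : slot G t -> R) : Prop :=
  feasible x /\
  forall y : slot G t -> R, feasible y -> extension s y <= extension s x.

Section SubMAPL.
Variables (theta0 : forall i : I, obs G i -> act G i -> R) (eta : R).

Definition gain_hat t (s : S) (a : jact G t) (i : active G t)
    (b : act G (val i)) : R :=
  gain (util M t s) (executed a :\ mkslot (a i))%SET (mkslot b).

Arguments gain_hat {t} s a i b.

Definition update t (s : S) (a : jact G t) (theta : tabular R G t) :
    tabular R G t :=
  fun i o b => if o == observe M i s then theta i o b + eta * gain_hat s a i b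
               else theta i o b.

(* Staying agents keep their logits, entering agents, including those that come
   back after having left, start from [theta0]. *)
Definition migrate t (theta : tabular R G t) : tabular R G t.+1 :=
  fun i => match @idP (val i \in active G t) with
           | ReflectT act_i => theta [` act_i]%fset
           | ReflectF _ => @theta0 (val i)
           end.

Fixpoint logits (n : nat) : hist n -> tabular R G n.+1 :=
  match n return hist n -> tabular R G n.+1 with
  | 0 => fun _ i => @theta0 (val i)
  | m.+1 => fun h => migrate (update (state h.1) h.2.1 (logits h.1))
  end.

Arguments logits {n} h i o b : rename.

Lemma measurable_logits n i o b :
  measurable_fun setT (fun h : hist n => logits h i o b).
Proof.
elim: n i o b => [|n IHn] i o b /=; first exact: measurable_cst.
rewrite /migrate; destruct (@idP (val i \in active G n.+1)) as [act_i|_];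
  last exact: measurable_cst.
set j := [` act_i]%fset; rewrite /update.
have mst : measurable_fun setT (fun h : hist n.+1 => state h.1).
  exact: (measurableT_comp (@measurable_state n) measurable_fst).
have mlog : measurable_fun setT (fun h : hist n.+1 => logits h.1 j o b).
  exact: (measurableT_comp (IHn j o b) measurable_fst).
apply: (measurable_observed (i := j) (g := fun h : hist n.+1 => state h.1)
    (f := fun o' h =>
  if o == o' then logits h.1 j o b + eta * gain_hat (state h.1) h.2.1 j b
  else logits h.1 j o b)) => // o'.
case: (o == o') => //; apply: measurable_funD => //.
apply: measurable_funM; first exact: measurable_cst.
apply: (measurable_fun_fin (f := fun a h => gain_hat (state h.1) a j b)
  (g := fun h : hist n.+1 => h.2.1)) => [a|a].
  apply: measurable_funB.
    exact: (measurableT_comp (measurable_util M _) mst).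
  exact: (measurableT_comp (measurable_util M _) mst).
rewrite -[X in measurable X]setTI.
by apply: (measurableT_comp measurable_fst measurable_snd).
Qed.

Lemma measurable_softmax n i o b :
  measurable_fun setT (fun h : hist n => softmax (logits h) i o b).
Proof.
have sum_gt0 h : 0 < \sum_c expR (logits h i o c).
  rewrite (bigD1 b)//= ltr_pwDl ?expR_gt0//.
  by apply: sumr_ge0 => c _; exact: expR_ge0.
rewrite (_ : (fun h => _) = (fun h =>
    expR (logits h i o b - ln (\sum_c expR (logits h i o c))))); last first.
  by apply/funext => h; rewrite expRB lnK ?posrE.
apply: measurableT_comp => //; apply: measurable_funB.
  exact: measurable_logits.
apply: measurableT_comp => //; apply: measurable_sum => c.
by apply: measurableT_comp => //; exact: measurable_logits.
Qed.

Definition submapl : policy_seq :=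
  @PolicySeq (fun n h => softmax (logits h)) (fun n h => @softmaxP _ _ _ _ (logits h))
    measurable_softmax.

Section TrackingVariation.
Variable xstar : forall t, S -> slot G t -> R.

Definition star t (s : S) (p : tabular R G t) : tabular R G t :=
  fun i o b => if o == observe M i s then xstar s (mkslot b) else p i o b.

Definition drift k (h : hist k) (a : jact G k.+1) (s' : S) : R :=
  let p := softmax (logits h) in
  let p_post := softmax (update (state h) a (logits h)) in
  let p_next := softmax (logits ((h, (a, s')) : hist k.+1)) in
  Num.max (KLtab (star s' p_next) p_next - KLtab (star (state h) p) p_post) 0.

Definition Vopen (T : nat) : R :=
  fine 'E_(law submapl T)[fun tau => \sum_(1 <= t < T) at_stage drift t tau].

Definition initial_KL : R :=
  let p1 : tabular R G 1 := softmax (fun i => @theta0 (val i)) in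
  fine 'E_(init M)[fun s => KLtab (star s p1) p1].

End TrackingVariation.

Definition DeltaT (T : nat) : R :=
  Num.max (Jstar T - fine 'E_(law submapl T)[fun tau =>
    \sum_(1 <= t < T.+1) at_stage (fun k h _ _ => Fstar k.+1 (state h)) t tau]) 0.

End SubMAPL.
End Process.

(* Main.v *)
(** Fix a stage with its history, and let [x] be the stagewise maximizer and [p]
    the current softmax policy.  Submodularity bounds the utility of any joint
    action [a'] by [F a + sum_i g_i(a'_i)], where [g_i] are the marginal gains
    observed when [a] is played, while normalization gives
    [sum_i g_i(a_i) <= F a].  Averaging over independent [a ~ p] and [a' ~ x]
    yields [F* - 2 E F <= E (sum_i <x_i - p_i, g_i>)].  The logit update is an
    exponential-weights step, so Hoeffding's lemma bounds [eta <x_i - p_i, g_i>]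
    by the decrease of [KL (x_i || p_i)] plus [(eta B)^2 / 2].  Taking
    expectations along the process and telescoping the divergences, whose jumps
    between stages are charged to the tracking variation, gives the bound; all
    the quantities involved are bounded and measurable, so no expectation
    degenerates. *)

Require Import Defs.
From HB Require Import structures.
From mathcomp Require Import all_boot all_order all_algebra finmap.
From mathcomp Require Import all_classical all_reals all_analysis.
From mathcomp Require Import measurable_realfun ring lra.

Set Implicit Arguments.
Unset Strict Implicit.
Unset Printing Implicit Defensive.

Import Order.TTheory GRing.Theory Num.Theory.
Import numFieldNormedType.Exports.

Local Open Scope classical_set_scope.
Local Open Scope ring_scope.

(** * Exponential weights and Kullback-Leibler divergence *)

(** The function [2 cosh y * exp (- y ^ 2 / 2)] equals 2 at 0 and is nonincreasing for [y >= 0], its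
    derivative having the sign of [sinh y - y cosh y]. *)
Lemma expR_addN_le (R : realType) (x : R) :
  0 <= x -> expR x + expR (- x) <= 2 * expR (x ^+ 2 / 2).
Proof.
(* [h y] is [2 (y cosh y - sinh y)], with derivative [2 y sinh y]. *)
pose h (y : R) := y * (expR y + expR (- y)) - (expR y - expR (- y)).
have dh y : is_derive y (1:R) h (y * (expR y - expR (- y))).
  rewrite /h; apply: is_derive_eq; rewrite /GRing.scale/=; ring.
have h_ge0 y : 0 <= y -> 0 <= h y.
  move=> y0; have -> : 0 = h 0 by rewrite /h mul0r oppr0 !subrr.
  apply: (@ger0_derive1_ndecry _ h 0) => //.
  - move=> z; rewrite in_itv/= andbT => z0; rewrite derive1E derive_val.
    by rewrite mulr_ge0 ?(ltW z0)// subr_ge0 ler_expR; lra.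
  - apply: continuous_subspaceT => z; apply: differentiable_continuous.
    exact/derivable1_diffP.
(* The sign is flipped so that [k] is nondecreasing, with derivative [h y * exp (- y ^ 2 / 2)]. *)
pose k (y : R) := - ((expR y + expR (- y)) * expR (- (y ^+ 2 / 2))).
have dk y : is_derive y (1:R) k (h y * expR (- (y ^+ 2 / 2))).
  rewrite /k /h; apply: is_derive_eq; rewrite /GRing.scale/=.
  rewrite !mulr0 add0r !mulr1 -mulr2n -[y *+ 2]mulr_natl mulKf//; ring.
move=> x0; have : k 0 <= k x.
  apply: (@ger0_derive1_ndecry _ k 0) => //.
  - move=> z; rewrite in_itv/= andbT => z0; rewrite derive1E derive_val.
    by rewrite mulr_ge0 ?expR_ge0// h_ge0// ltW.
  - apply: continuous_subspaceT => z; apply: differentiable_continuous.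
    exact/derivable1_diffP.
rewrite /k oppr0 expr0n/= mul0r oppr0 expR0 mulr1 lerN2 -[1 + 1]/(2 : R).
by rewrite [expR (- (x ^+ 2 / 2))]expRN ler_pdivrMr ?expR_gt0.
Qed.

(* Hoeffding's lemma with [1 / 2] in place of the optimal [1 / 8]: [z] is only
   used to lie within [c] of its mean, which suffices for the constant of the
   theorem and needs nothing beyond [cosh c <= exp (c ^ 2 / 2)]. *)
Lemma ln_mean_expR_le (R : realType) (A : finType) (p z : A -> R) (c : R) :
  (forall b, 0 <= p b) -> \sum_b p b = 1 -> (forall b, 0 <= z b <= c) ->
  ln (\sum_b p b * expR (z b)) <= \sum_b p b * z b + c ^+ 2 / 2.
Proof.
move=> p0 p1 zc; set m := \sum_b p b * z b.
(* For [c <= 0] the bounds force [z = 0]; the case is set apart because the chord used below has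
   width [2 * c]. *)
have [c0|c0] := leP c 0.
  have z0 b : z b = 0 by have /andP[? ?] := zc b; apply/eqP; lra.
  rewrite (eq_bigr p) => [|b _]; last by rewrite z0 expR0 mulr1.
  by rewrite p1 ln1 /m big1 => [|b _]; rewrite ?z0 ?mulr0// add0r divr_ge0// sqr_ge0.
have m0 : 0 <= m by apply: sumr_ge0 => b _; rewrite mulr_ge0//; case/andP: (zc b).
have mc : m <= c.
  rewrite -[leRHS]mul1r -p1 mulr_suml ler_sum// => b _.
  by rewrite ler_wpM2l//; case/andP: (zc b).
(* Convexity puts [exp] below its chord over [[-c, c]], which contains [z b - m] because [z b] and
   the mean both lie in [[0, c]]. On averaging, the slope term vanishes and [cosh c] remains. *)
have cosh_bound b : expR (z b - m) <=
    (expR c + expR (- c)) / 2 + (z b - m) * ((expR c - expR (- c)) / (2 * c)).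
  have /andP[zb0 zbc] := zc b.
  have t01 : 0 <= (c - (z b - m)) / (2 * c) <= 1.
    apply/andP; split; first by apply: divr_ge0; lra.
    by rewrite ler_pdivrMr ?mulr_gt0// mul1r; lra.
  pose t := Itv01 (proj1 (andP t01)) (proj2 (andP t01)).
  have := convex_expR t (- c) c; rewrite !convRE/= /unstable.onem.
  have c_neq0 : c != 0 by rewrite gt_eqF.
  rewrite (_ : _ * - c + _ * c = z b - m); last by field.
  move=> /le_trans; apply; rewrite le_eqVlt; apply/orP; left; apply/eqP.
  by field.
have : \sum_b p b * expR (z b - m) <= expR (c ^+ 2 / 2).
  apply: (@le_trans _ _ ((expR c + expR (- c)) / 2)); last first.
    by rewrite ler_pdivrMr// [leRHS]mulrC expR_addN_le// ltW.
  apply: (@le_trans _ _ (\sum_b p b * ((expR c + expR (- c)) / 2 +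
      (z b - m) * ((expR c - expR (- c)) / (2 * c))))).
    by apply: ler_sum => b _; rewrite ler_wpM2l.
  set u := _ / 2; set v := _ / (2 * c).
  under eq_bigr do rewrite mulrDr mulrA.
  rewrite big_split/= -!mulr_suml p1 mul1r.
  have -> : \sum_b p b * (z b - m) = 0.
    by under eq_bigr do rewrite mulrBr; rewrite sumrB -mulr_suml p1 mul1r subrr.
  by rewrite mul0r addr0.
have -> : \sum_b p b * expR (z b - m) = (\sum_b p b * expR (z b)) * expR (- m).
  by rewrite mulr_suml; apply: eq_bigr => b _; rewrite expRD mulrA.
(* [p] may vanish at some points, so positivity comes from its total mass being 1. *)
have S0 : 0 < \sum_b p b * expR (z b).
  rewrite lt_neqAle sumr_ge0 ?andbT => [|b _]; last by rewrite mulr_ge0 ?expR_ge0.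
  apply/eqP => /esym/eqP; rewrite psumr_eq0 => [/allP p_eq0|b _]; last first.
    by rewrite mulr_ge0 ?expR_ge0.
  move: p1; rewrite big1 => [/esym/eqP|b _]; first by rewrite oner_eq0.
  have := p_eq0 b (mem_index_enum b).
  by rewrite /= mulf_eq0 (gt_eqF (expR_gt0 _)) orbF => /eqP.
rewrite -[X in X <= _ -> _]lnK ?posrE ?mulr_gt0 ?expR_gt0// ler_expR.
by rewrite lnM ?posrE ?expR_gt0// expRK; lra.
Qed.

(** * Divergence from exponential-weights distributions *)

Section KLFacts.
Variables (R : realType) (A : finType).
Implicit Types p q z theta : A -> R.

Lemma mul_lnV p q b : 0 <= p b -> 0 < q b ->
  p b * ln (p b / q b) = p b * ln (p b) - p b * ln (q b).
Proof.
rewrite le_eqVlt => /predU1P[<- _|p0 q0]; first by rewrite !mul0r subrr.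
by rewrite ln_div ?posrE// mulrBr.
Qed.

Lemma KLE p q : (forall b, 0 <= p b) -> (forall b, 0 < q b) ->
  KL p q = \sum_b (p b * ln (p b) - p b * ln (q b)).
Proof. by move=> p0 q0; apply: eq_bigr => b _; exact: mul_lnV. Qed.

(** Gibbs' inequality: [ln u <= u - 1] at [u = q b / p b] bounds each term below by [p b - q b], and
    these differences sum to 0. *)
Lemma KL_ge0 p q : (forall b, 0 <= p b) -> \sum_b p b = 1 ->
  (forall b, 0 < q b) -> \sum_b q b = 1 -> 0 <= KL p q.
Proof.
move=> p0 p1 q0 q1; rewrite /KL.
apply: (@le_trans _ _ (\sum_b (p b - q b))); first by rewrite sumrB p1 q1 subrr.
apply: ler_sum => b _.
have := p0 b; rewrite le_eqVlt => /predU1P[<-|pb0].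
  by rewrite mul0r sub0r oppr_le0 ltW.
rewrite -[p b / q b]invrK invf_div lnV ?posrE ?divr_gt0// mulrN lerNr opprB.
have -> : q b - p b = p b * (q b / p b - 1) by field; rewrite gt_eqF.
rewrite ler_pM2l//.
have := @le_ln1Dx _ (q b / p b - 1); rewrite [1 + _]addrC subrK; apply.
by rewrite ltrBrDl subrr divr_gt0.
Qed.

(** One row of [softmax], at a fixed agent and observation; the two unfold to the same
    expression. *)
Definition gibbs theta b := expR (theta b) / \sum_c expR (theta c).

Lemma sum_expR_gt0 theta (b : A) : 0 < \sum_c expR (theta c).
Proof.
rewrite (bigD1 b)//= ltr_pwDl ?expR_gt0//.
by apply: sumr_ge0 => c _; exact: expR_ge0.
Qed.

Lemma gibbs_gt0 theta b : 0 < gibbs theta b.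
Proof. by rewrite divr_gt0 ?expR_gt0// (sum_expR_gt0 _ b). Qed.

(** The argument of type [A] is a witness of nonemptiness, without which the sum is 0. *)
Lemma sum_gibbs theta : A -> \sum_b gibbs theta b = 1.
Proof. by move=> b; rewrite -mulr_suml divff// gt_eqF// (sum_expR_gt0 _ b). Qed.

(** Adding [z] to the logits reweights by [exp z] and divides by its mean [S], so the divergence
    from [p] drops by exactly [<p, z> - ln S]. Hoeffding's bound on [ln S] then gives the claim. *)
Lemma KL_gibbs_step p theta z c :
  (forall b, 0 <= p b) -> \sum_b p b = 1 -> (forall b, 0 <= z b <= c) ->
  \sum_b (p b - gibbs theta b) * z b <=
  KL p (gibbs theta) - KL p (gibbs (theta \+ z)) + c ^+ 2 / 2.
Proof.
move=> p0 p1 zc.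
have [b0 _|A0] := pickP (predT : pred A); last first.
  by move: p1; rewrite big_pred0// => /esym/eqP; rewrite oner_eq0.
set S := \sum_b gibbs theta b * expR (z b).
have tilt b : gibbs (theta \+ z) b = gibbs theta b * expR (z b) / S.
  have -> : S = (\sum_c expR (theta c + z c)) / \sum_c expR (theta c).
    by rewrite /S mulr_suml; apply: eq_bigr => c' _; rewrite expRD mulrAC.
  have := sum_expR_gt0 theta b; have := sum_expR_gt0 (theta \+ z) b.
  rewrite /gibbs /= expRD; move: (\sum_c _) (\sum_c _) => u v u0 v0.
  by field; rewrite !gt_eqF.
have S0 : 0 < S.
  rewrite /S (bigD1 b0)//=; apply: ltr_pwDl.
    by apply: mulr_gt0; [exact: gibbs_gt0|exact: expR_gt0].
  by apply: sumr_ge0 => c' _; rewrite mulr_ge0 ?expR_ge0// ltW ?gibbs_gt0.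
have -> : KL p (gibbs theta) - KL p (gibbs (theta \+ z)) =
    \sum_b p b * z b - ln S.
  rewrite !KLE// => [|b|b]; [|exact: gibbs_gt0..].
  rewrite -sumrB -[ln S]mul1r -p1 mulr_suml -sumrB; apply: eq_bigr => b _.
  rewrite tilt; move: (gibbs theta b) (gibbs_gt0 theta b) => g g0.
  rewrite ln_div ?posrE ?mulr_gt0 ?expR_gt0// lnM ?posrE ?expR_gt0// expRK.
  ring.
rewrite (eq_bigr _ (fun b _ => mulrBl _ _ _)) sumrB.
have := @ln_mean_expR_le R A (gibbs theta) z c
  (fun b => ltW (gibbs_gt0 theta b)) (sum_gibbs theta b0) zc.
by rewrite -/S; lra.
Qed.

End KLFacts.

(** * The one-stage inequality *)

Section SetFunctionFacts.
Variables (R : realType) (E : finType) (f : {set E} -> R).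
Implicit Types (A : {set E}) (e : E).
Hypotheses (f0 : set_normalized f) (fmono : set_monotone f).
Hypothesis fsub : set_submodular f.

Lemma gain_ge0 A e : 0 <= gain f A e.
Proof. by rewrite subr_ge0 fmono// finset.subsetUr. Qed.

Lemma gain_mem A e : e \in A -> gain f A e = 0.
Proof.
by move=> eA; rewrite /gain (finset.setUidPr _) ?subrr// finset.sub1set.
Qed.

(** Extends submodularity to [e] in [A'], where the left gain is 0 and the right one is nonnegative
    by monotonicity. *)
Lemma gain_anti A A' e : A \subset A' -> gain f A' e <= gain f A e.
Proof.
move=> AA'; have [eA'|eA'] := boolP (e \in A'); last exact: fsub.
by rewrite (gain_mem eA') gain_ge0.
Qed.

(** The elements of [r] are added one at a time, each contributing at most its gain over the smaller
    set [A]. *)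
Lemma setU_le_sum_gain A (r : seq E) :
  f (A :|: [set e in r])%SET <= f A + \sum_(e <- r) gain f A e.
Proof.
elim: r => [|e r IHr].
  rewrite big_nil addr0 fmono//; apply/fintype.subsetP => e.
  by rewrite !inE orbF.
rewrite finset.set_cons finset.setUCA big_cons.
have := @gain_anti A (A :|: [set e in r])%SET e (finset.subsetUl _ _).
by move: IHr; rewrite /gain; lra.
Qed.

(** The utility telescopes into gains over growing sets, and each gain only decreases when measured
    against all the other elements. Normalization starts the telescoping at 0. *)
Lemma sum_gain_setD1_le (r : seq E) : uniq r ->
  \sum_(e <- r) gain f ([set x in r] :\ e)%SET e <= f [set x in r]%SET.
Proof.
elim: r => [|e0 r IHr]; first by rewrite big_nil -f0 fmono// finset.sub0set.
rewrite cons_uniq big_cons finset.set_cons => /andP[e0r /IHr{}IHr].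
rewrite finset.setU1K ?inE// {1}/gain.
have : \sum_(e <- r) gain f ((e0 |: [set x in r]) :\ e)%SET e <= f [set x in r]%SET.
  apply: le_trans IHr; apply: ler_sum => e _; apply: gain_anti.
  by apply: finset.setSD; exact: finset.subsetUr.
lra.
Qed.

(** Supplies a bound on the utilities that is uniform in the state, hence their integrability. *)
Lemma le_card_gain (B : R) A : (forall e, gain f finset.set0 e <= B) ->
  f A <= #|A|%:R * B.
Proof.
move=> fB; have := @setU_le_sum_gain finset.set0 (enum A).
rewrite finset.set0U f0 add0r (_ : [set e in enum A]%SET = A); last first.
  by apply/finset.setP => x; rewrite inE mem_enum.
move=> /le_trans; apply; rewrite cardE -sum1_size natr_sum mulr_suml.
by apply: ler_sum => e _; rewrite mul1r.
Qed.

End SetFunctionFacts.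

(** * Independent draws and unilateral deviations *)

Section JointActions.
Variables (R : realType) (I : choiceType) (G : open_system I) (t : nat).
Local Notation agent := (fset_sub_type (active G t)).
Implicit Types (a : jact G t) (x y : forall i : agent, act G (val i) -> R).

Definition deviate a (i : agent) (b : act G (val i)) : jact G t :=
  [ffun j => eqtype.dfwith (fun k => a k) b j].

Arguments deviate : clear implicits.

Lemma deviateE a i (b : act G (val i)) : deviate a i b i = b.
Proof. by rewrite ffunE dfwith_in. Qed.

Lemma deviate_out a i (b : act G (val i)) j : i != j -> deviate a i b j = a j.
Proof. by move=> ij; rewrite ffunE dfwith_out. Qed.

Lemma deviateK a i (b : act G (val i)) : deviate (deviate a i b) i (a i) = a.
Proof.
apply/ffunP => j; rewrite ffunE.
by case: eqtype.dfwithP => // k ik; rewrite deviate_out.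
Qed.

(** Serves for both [joint_prob], with the policy rows at the observed state, and the weights of
    [extension]. *)
Definition product x a : R := \prod_(i : agent) x i (a i).

Lemma product_ge0 x a : (forall i b, 0 <= x i b) -> 0 <= product x a.
Proof. by move=> x0; apply: prodr_ge0 => i _. Qed.

Lemma sum_product x : (forall i, \sum_b x i b = 1) -> \sum_a product x a = 1.
Proof. by move=> x1; rewrite sum_jact_prod big1. Qed.

(* Exchanging the action of agent [i] with an independent copy of it preserves
   the joint law. *)
Lemma sum_product_resample x i (g : act G (val i) -> jact G t -> R) :
  (forall i, \sum_b x i b = 1) ->
  (forall b a c, g b (deviate a i c) = g b a) ->
  \sum_a product x a * g (a i) a = \sum_a product x a * \sum_b x i b * g b a.
Proof.
(* [ab.2] is the independent copy; [swap] exchanges it with the action of [i] in [ab.1]. This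
   involution preserves the weight [product x ab.1 * x i ab.2]. *)
move=> x1 g_inv; pose swap (ab : jact G t * act G (val i)) :=
  (deviate ab.1 i ab.2, ab.1 i).
have swapK : involutive swap.
  by case=> a b; rewrite /swap/= deviateE deviateK.
transitivity (\sum_(ab : jact G t * act G (val i))
    product x ab.1 * x i ab.2 * g (ab.1 i) ab.1).
  rewrite -(pair_bigA _ (fun a b => product x a * x i b * g (a i) a))/=.
  apply: eq_bigr => a _; rewrite -mulr_suml -mulr_sumr x1 mulr1//.
rewrite (reindex_inj (inv_inj swapK))/=.
under [RHS]eq_bigr do rewrite mulr_sumr.
rewrite [RHS](pair_bigA _ (fun a b => product x a * (x i b * g b a)))/=.
apply: eq_bigr => -[a b] _ /=; rewrite deviateE g_inv mulrA; congr (_ * _).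
rewrite /product (bigD1 i)//= [in RHS](bigD1 i)//= deviateE.
rewrite (eq_bigr (fun j => x j (a j))) => [|j ji].
  by rewrite mulrAC [RHS]mulrAC [x i b * _]mulrC.
by rewrite deviate_out// eq_sym.
Qed.

Lemma sum_product_marginal x i (phi : act G (val i) -> R) :
  (forall i, \sum_b x i b = 1) ->
  \sum_a product x a * phi (a i) = \sum_b x i b * phi b.
Proof.
move=> x1; rewrite (@sum_product_resample x i (fun b _ => phi b))//.
by rewrite -mulr_suml sum_product// mul1r.
Qed.

Lemma mkslot_inj_agent a : injective (fun i : agent => mkslot (a i)).
Proof. by move=> i j /(congr1 tag). Qed.

Lemma executedE a : executed a = [set e in [seq mkslot (a i) | i <- enum agent]]%SET.
Proof.
by apply/finset.setP => e; rewrite inE; apply/imsetP/mapP => -[i iE ->];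
  exists i => //; rewrite ?mem_enum.
Qed.

Lemma executed_deviate a i (b : act G (val i)) :
  (executed (deviate a i b) :\ mkslot (deviate a i b i) = executed a :\ mkslot (a i))%SET.
Proof.
apply/finset.setP => e; rewrite !inE.
apply/andP/andP => -[ne /imsetP[j _ eE]]; rewrite {e}eE in ne *.
- have ij : i != j by apply: contra_neq ne => <-.
  rewrite deviate_out//; split; last exact: imset_f.
  by apply: contra_neq ij => /(congr1 tag).
- have ij : i != j by apply: contra_neq ne => <-.
  rewrite -(deviate_out a b ij); split; last exact: imset_f.
  by apply: contra_neq ij => /(congr1 tag).
Qed.

(** The bound on gains concerns slots outside the set; with the executed slot of [i] removed, every
    slot of [i] is outside. *)
Lemma mkslot_notin_rest a i (b : act G (val i)) :
  mkslot b \notin (executed a :\ mkslot (a i))%SET.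
Proof.
rewrite !inE; apply/negP => /andP[/negP ne /imsetP[j _]] e.
have ij : i = j by have := congr1 tag e.
by apply: ne; rewrite e -ij.
Qed.

End JointActions.
Arguments deviate {I G t} a i b.

(** * The stage at a fixed state: comparator, gains and mirror step *)

Section Stage.
Variables (R : realType) (I : choiceType) (G : open_system I).
Variables (d : measure_display) (S : measurableType d) (M : open_mdp R G S).
Variables (t : nat) (s : S) (B : R).
Local Notation agent := (fset_sub_type (active G t)).
Local Notation F := (util M t s).
Hypotheses (F0 : set_normalized F) (Fmono : set_monotone F).
Hypothesis Fsub : set_submodular F.
Hypothesis FB : forall (A : {set slot G t}) e, e \notin A -> 0 <= gain F A e <= B.

Lemma eq_mkslot (i : agent) (b c : act G (val i)) :
  (mkslot b == mkslot c) = (b == c).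
Proof. exact: (eq_Tagged (u := mkslot b) c). Qed.

Lemma mkslot_in_executed (a : jact G t) (i : agent) b :
  (mkslot b \in executed a) = (b == a i).
Proof.
apply/imsetP/eqP => [[j _ e]|->]; last by exists i.
have ij : i = j by have := congr1 tag e.
by subst j; apply/eqP; rewrite -eq_mkslot e.
Qed.

(** Each agent has at most one slot in [A], which [pick] selects; agents without a slot receive a
    default action. *)
Lemma independent_sub_executed (A : {set slot G t}) :
  A \in independent t -> exists a : jact G t, A \subset executed a.
Proof.
rewrite inE => /forallP A1.
exists [ffun i => if [pick b | mkslot b \in A] is Some b then b
                  else jact_witness G t i].
apply/fintype.subsetP => -[i b] eA; rewrite (mkslot_in_executed _ (i := i) b) ffunE.
case: pickP => [b' b'A|/(_ b)]; last by rewrite eA.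
have /card_le1_eqP := A1 i.
move=> /(_ (mkslot b') (mkslot b)).
rewrite !inE eA b'A !eqxx => /(_ isT isT)/eqP.
by rewrite eq_mkslot.
Qed.

Lemma extension_point_mass (a : jact G t) :
  extension M s (fun e => (e \in executed a)%:R) = F (executed a).
Proof.
rewrite /extension (bigD1 a)//= big1 => [|i _]; last first.
  by rewrite mkslot_in_executed eqxx.
rewrite mul1r big1 ?addr0// => a' /eqP ne.
have [i ai] : exists i, a' i != a i.
  apply: contrapT => /forallNP eq_a; apply: ne; apply/ffunP => i.
  by have /negP/negPn/eqP := eq_a i.
by rewrite (bigD1 i)//= mkslot_in_executed (negbTE ai) !mul0r.
Qed.

Lemma point_mass_feasible (a : jact G t) :
  feasible (fun e : slot G t => (e \in executed a)%:R : R).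
Proof.
split=> [e|i]; first by rewrite ler0n lern1; case: (_ \in _).
rewrite (bigD1 (a i))//= mkslot_in_executed eqxx big1 ?addr0// => b /negbTE ba.
by rewrite mkslot_in_executed ba.
Qed.

(** By monotonicity an independent set can be completed to a full joint action, and the indicator of
    its slots is a feasible point of the extension with the same value. *)
Lemma Fstar_le_extension (x : slot G t -> R) :
  stage_maximizer M s x -> Fstar M t s <= extension M s x.
Proof.
move=> [_ x_max].
have le_ext A : A \in independent t -> F A <= extension M s x.
  move=> /independent_sub_executed[a Aa]; apply: (le_trans (Fmono Aa)).
  by rewrite -extension_point_mass; apply: x_max; exact: point_mass_feasible.
rewrite /Fstar; apply: bigmax_le => // .
(* The starting value of the maximum is the utility of the empty set, which is itself
   independent. *)
apply: le_ext; rewrite inE; apply/forallP => i.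
apply: (@leq_trans #|(finset.set0 : {set slot G t})|); last by rewrite cards0.
by apply/subset_leq_card/fintype.subsetP => e; rewrite !inE.
Qed.

Lemma gain_hat_bounds (a : jact G t) (i : agent) b :
  0 <= gain_hat M s a (i := i) b <= B.
Proof. by apply: FB; exact: mkslot_notin_rest. Qed.

Lemma gain_hat_deviate (a : jact G t) (i : agent) b c :
  gain_hat M s (deviate a i c) (i := i) b = gain_hat M s a (i := i) b.
Proof. by rewrite /gain_hat executed_deviate. Qed.

(** Passing to the union with [executed a] costs nothing by monotonicity. Submodularity then allows
    each gain to be measured over the set without the slot of its own agent. *)
Lemma util_le_sum_gain_hat (a a' : jact G t) :
  F (executed a') <= F (executed a) + \sum_(i : agent) gain_hat M s a (a' i).
Proof.
apply: (@le_trans _ _ (F (executed a :|: executed a')%SET)).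
  by apply: Fmono; exact: finset.subsetUr.
rewrite (executedE a'); apply: (le_trans (setU_le_sum_gain Fmono Fsub _ _)).
rewrite lerD2l big_map big_enum/=; apply: ler_sum => i _.
by apply: gain_anti => //; exact: finset.subsetDl.
Qed.

Lemma sum_gain_hat_le_util (a : jact G t) :
  \sum_(i : agent) gain_hat M s a (a i) <= F (executed a).
Proof.
have := @sum_gain_setD1_le _ _ _ F0 Fmono Fsub [seq mkslot (a i) | i <- enum agent].
rewrite map_inj_uniq; last exact: mkslot_inj_agent.
by rewrite enum_uniq -executedE big_map big_enum; apply.
Qed.

Section MirrorStep.
Variables (xstar : forall t : nat, S -> slot G t -> R) (theta : tabular R G t).
Variable eta : R.
Hypotheses (x_max : stage_maximizer M s (@xstar t s)) (eta0 : 0 < eta).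
Local Notation x i b := (xstar s (@mkslot I G t i b)).
Local Notation p := (softmax theta).
Local Notation q a := (softmax (update M eta s a theta)).
Local Notation o := (observe M ^~ s).

Lemma stage_maximizer_ge0 (i : agent) b : 0 <= x i b.
Proof. by case: x_max => -[x01 _] _; case/andP: (x01 (mkslot b)). Qed.

Lemma stage_maximizer_sum (i : agent) : \sum_b x i b = 1.
Proof. by case: x_max => -[_ x1] _. Qed.

(** For each agent, [KL_gibbs_step] with increments [eta * gain_hat], which lie in [[0, eta * B]].
    Only the row of the current observation changes; in the others the two divergences coincide and
    cancel. *)
Lemma mirror_step (a : jact G t) :
  eta * \sum_(i : agent) \sum_b
    (x i b - p i (o i) b) * gain_hat M s a (i := i) b <=
  KLtab (star M xstar s p) p - KLtab (star M xstar s p) (q a)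
  + #|{: agent}|%:R * ((eta * B) ^+ 2 / 2).
Proof.
rewrite -sum1_card natr_sum mulr_suml mulr_sumr /KLtab -sumrB -big_split/=.
apply: ler_sum => i _; rewrite mul1r -sumrB (bigD1 (o i))//= [X in _ + X + _]big1 => [|o' ne].
  rewrite addr0 mulr_sumr.
  have := @KL_gibbs_step _ _ (fun b => x i b) (@theta i (o i))
    (fun b => eta * gain_hat M s a (i := i) b) (eta * B).
  have -> : gibbs (@theta i (o i) \+ (fun b => eta * gain_hat M s a (i := i) b)) =
      q a i (o i).
    by apply/funext => b; rewrite /softmax /gibbs /update eqxx.
  have -> : @star _ _ _ _ _ M xstar t s p i (o i) = (fun b => x i b).
    by apply/funext => b; rewrite /star eqxx.
  move=> step; under eq_bigr do rewrite mulrCA.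
  apply: step.
  - exact: stage_maximizer_ge0.
  - exact: stage_maximizer_sum.
  - move=> b; have /andP[g0 gB] := gain_hat_bounds a b.
    by rewrite mulr_ge0 ?(ltW eta0)//= ler_pM2l.
rewrite /KL -sumrB big1// => b _.
suff -> : q a i o' b = p i o' b by rewrite subrr.
rewrite /softmax /update (negbTE ne)//.
Qed.

Lemma stage_inequality :
  \sum_a joint_prob M p s a *
    (eta * (Fstar M t s - 2 * F (executed a))) <=
  \sum_a joint_prob M p s a *
    (KLtab (star M xstar s p) p - KLtab (star M xstar s p) (q a)
     + #|{: agent}|%:R * ((eta * B) ^+ 2 / 2)).
Proof.
pose w a := joint_prob M p s a.
have wE : w = product (fun i b => p i (o i) b) by [].
have p1 i : \sum_b p i (o i) b = 1 by have [] := @softmaxP _ _ _ _ theta i (o i).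
have w0 a : 0 <= w a.
  by rewrite wE product_ge0// => i b; have [] := @softmaxP _ _ _ _ theta i (o i).
have w1 : \sum_a w a = 1 by rewrite wE sum_product.
pose gx a := \sum_(i : agent) \sum_b x i b * gain_hat M s a (i := i) b.
pose gp a := \sum_(i : agent) \sum_b p i (o i) b * gain_hat M s a (i := i) b.
(* With [a] fixed, [util_le_sum_gain_hat] is averaged over [a'] drawn from the comparator; only its
   marginals matter in the sum of gains. *)
have Fstar_le a : Fstar M t s <= F (executed a) + gx a.
  apply: (le_trans (Fstar_le_extension x_max)); rewrite /extension.
  apply: (@le_trans _ _ (\sum_a' product (fun i b => x i b) a' *
      (F (executed a) + \sum_(i : agent) gain_hat M s a (a' i)))).
    apply: ler_sum => a' _; rewrite ler_wpM2l ?util_le_sum_gain_hat//.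
    by apply: prodr_ge0 => i _; exact: stage_maximizer_ge0.
  under eq_bigr do rewrite mulrDr mulr_sumr.
  rewrite big_split/= -mulr_suml sum_product; last exact: stage_maximizer_sum.
  rewrite mul1r lerD2l exchange_big/= ler_sum// => i _.
  rewrite (@sum_product_marginal _ _ _ _ (fun i b => x i b) i
    (fun b => gain_hat M s a (i := i) b))//.
  exact: stage_maximizer_sum.
(* The gains of agent [i] do not depend on its own action, so the average over a fresh draw can be
   replaced by the value at the drawn action. *)
have gp_le : \sum_a w a * gp a <= \sum_a w a * F (executed a).
  apply: (@le_trans _ _ (\sum_a w a * \sum_(i : agent) gain_hat M s a (a i))).
    rewrite /gp; under eq_bigr do rewrite mulr_sumr.
    under [leRHS]eq_bigr do rewrite mulr_sumr.
    rewrite exchange_big [leRHS]exchange_big/= ler_sum// => i _; rewrite wE.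
    rewrite -(@sum_product_resample _ _ _ _ (fun i b => p i (o i) b) i
      (fun b a => gain_hat M s a (i := i) b))// => b a c.
    exact: gain_hat_deviate.
  by apply: ler_sum => a _; rewrite ler_wpM2l// sum_gain_hat_le_util.
apply: (@le_trans _ _ (\sum_a w a * (eta * (gx a - gp a)))); last first.
  apply: ler_sum => a _; rewrite ler_wpM2l//; apply: le_trans (mirror_step a).
  rewrite /gx /gp -sumrB ler_pM2l// le_eqVlt; apply/orP; left; apply/eqP.
  apply: eq_bigr => i _; rewrite -sumrB.
  by apply: eq_bigr => b _; rewrite mulrBl.
apply: (@le_trans _ _ (\sum_a w a * (eta * (gx a - F (executed a))))).
  apply: ler_sum => a _; rewrite ler_wpM2l// ler_pM2l//.
  by have := Fstar_le a; lra.
have comb (h : jact G t -> R) : \sum_a w a * (eta * (gx a - h a)) =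
    eta * (\sum_a w a * gx a - \sum_a w a * h a).
  by rewrite -sumrB mulr_sumr; apply: eq_bigr => a _; rewrite mulrCA mulrBr.
by rewrite !comb ler_pM2l// lerD2l lerN2.
Qed.

End MirrorStep.
End Stage.

(** * Bounded measurable functions and the trajectory law *)

Section Density.
Context d1 d2 (X : measurableType d1) (Y : measurableType d2) (R : realType).
Variables (mu : {measure set X -> \bar R}) (nu : {measure set Y -> \bar R}).
Variables (g : Y -> X) (U : set Y) (p : X -> R).
Hypotheses (mg : measurable_fun setT g) (mU : measurable U).
Hypotheses (mp : measurable_fun setT p) (p0 : forall x, 0 <= p x).
Hypothesis density : forall A, measurable A ->
  nu (U `&` g @^-1` A) = (\int[mu]_(x in A) (p x)%:E)%E.
Import HBNNSimple.

Let mgpre A : measurable A -> measurable (g @^-1` A).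
Proof. by move=> mA; rewrite -[X in measurable X]setTI; exact: mg. Qed.

Let integral_density_nnsfun (h : {nnsfun X >-> R}) :
  (\int[nu]_(y in U) (h (g y))%:E = \int[mu]_x (p x * h x)%:E)%E.
Proof.
under eq_integral do rewrite fimfunE -fsumEFin//.
rewrite ge0_integral_fsum//; last 2 first.
- move=> r; apply/measurable_EFinP; apply: measurable_funM => //.
  by apply: measurable_funTS; apply: measurableT_comp.
- by move=> r y _; rewrite EFinM nnfun_muleindic_ge0.
under [RHS]eq_integral => x _.
  rewrite EFinM fimfunE -fsumEFin// ge0_mule_fsumr; last first.
    by move=> r; rewrite EFinM nnfun_muleindic_ge0.
  over.
rewrite [RHS]ge0_integral_fsum//; last 2 first.
- move=> r; apply/measurable_EFinP; do 2 apply: measurable_funM => //.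
- move=> r x _; apply: mule_ge0; first by rewrite lee_fin.
  by rewrite EFinM nnfun_muleindic_ge0.
apply: eq_fsbigr => r; rewrite inE => -[x _ hx].
have r0 : 0 <= r by rewrite -hx.
under eq_integral do rewrite EFinM.
rewrite ge0_integralZl//; last first.
  by apply/measurable_EFinP; apply: measurable_funTS; apply: measurableT_comp.
under [RHS]eq_integral do rewrite EFinM muleCA.
rewrite ge0_integralZl//; last 2 first.
- by apply/measurable_EFinP; apply: measurable_funM.
- by move=> y _; rewrite -EFinM lee_fin mulr_ge0.
congr (_ * _)%E.
transitivity (\int[nu]_(y in U) (\1_(g @^-1` (h @^-1` [set r])) y)%:E)%E.
  by apply: eq_integral.
rewrite integral_indic//; last exact: mgpre.
rewrite setIC density// integral_mkcond; apply: eq_integral => y _.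
by rewrite patchE indicE; case: ifPn => _; rewrite ?mule1 ?mule0.
Qed.

(** The hypothesis [density] says that the image by [g] of [nu] restricted to [U] has density [p]
    with respect to [mu]. The change of variables passes from indicators to simple functions by
    linearity, then to [f] by monotone convergence. *)
Lemma ge0_integral_density (f : X -> R) :
  measurable_fun setT f -> (forall x, 0 <= f x) ->
  (\int[nu]_(y in U) (f (g y))%:E = \int[mu]_x (p x * f x)%:E)%E.
Proof.
move=> mf f0; pose fe x := (f x)%:E.
have mfe : measurable_fun setT fe by exact/measurable_EFinP.
have fe0 x : (0 <= fe x)%E by rewrite lee_fin.
pose f_ := nnsfun_approx measurableT mfe.
have f_cvg x : (f_ n x)%:E @[n --> \oo] --> fe x by apply: cvg_nnsfun_approx.
have f_nd x : {homo (fun n => f_ n x) : m n / (m <= n)%N >-> m <= n}.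
  by move=> m n mn; exact/lefP/nd_nnsfun_approx.
transitivity (lim (\int[nu]_(y in U) (f_ n (g y))%:E @[n --> \oo])%E).
  rewrite -monotone_convergence//=.
  - by apply: eq_integral => y _; apply/esym/cvg_lim.
  - move=> n; apply/measurable_EFinP; apply: measurable_funTS.
    exact: measurableT_comp.
  - by move=> n y _; rewrite lee_fin.
  - by move=> y _ m n mn; rewrite lee_fin f_nd.
rewrite (_ : (fun n => _) = (fun n => \int[mu]_x (p x * f_ n x)%:E)%E); last first.
  by apply/funext => n; exact: integral_density_nnsfun.
rewrite -monotone_convergence//=.
- apply: eq_integral => x _; apply/cvg_lim => //.
  under eq_cvg do rewrite EFinM.
  exact: (@cvgeZl _ _ _ _ _ (p x)%:E _ (f_cvg x)).
- by move=> n; apply/measurable_EFinP; apply: measurable_funM.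
- by move=> n x _; rewrite lee_fin mulr_ge0.
- by move=> x _ m n mn; rewrite lee_fin ler_wpM2l// f_nd.
Qed.

End Density.

(** * Closure properties of bounded measurable functions *)

Section BoundedMeasurable.
Context d (X : measurableType d) (R : realType).
Implicit Types f g : X -> R.

(** Such functions are integrable under every probability, so their means are genuine and linear. *)
Definition bmeas f := measurable_fun setT f /\ exists C, forall x, `|f x| <= C.

Lemma bmeas_cst (c : R) : bmeas (fun=> c).
Proof. by split; [exact: measurable_cst|exists `|c|]. Qed.

Lemma bmeasD f g : bmeas f -> bmeas g -> bmeas (fun x => f x + g x).
Proof.
move=> [mf [C fC]] [mg [D gD]]; split; first exact: measurable_funD.
by exists (C + D) => x; rewrite (le_trans (ler_normD _ _))// lerD.
Qed.

Lemma bmeasM f g : bmeas f -> bmeas g -> bmeas (fun x => f x * g x).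
Proof.
move=> [mf [C fC]] [mg [D gD]]; split; first exact: measurable_funM.
by exists (C * D) => x; rewrite normrM ler_pM.
Qed.

Lemma bmeasN f : bmeas f -> bmeas (fun x => - f x).
Proof.
move=> [mf [C fC]]; split; first exact: measurableT_comp.
by exists C => x; rewrite normrN.
Qed.

Lemma bmeasB f g : bmeas f -> bmeas g -> bmeas (fun x => f x - g x).
Proof. by move=> bf /bmeasN; exact: bmeasD. Qed.

Lemma bmeas_max f g : bmeas f -> bmeas g -> bmeas (fun x => Num.max (f x) (g x)).
Proof.
move=> [mf [C fC]] [mg [D gD]]; split; first exact: measurable_maxr.
exists (C + D) => x.
have C0 := le_trans (normr_ge0 _) (fC x); have D0 := le_trans (normr_ge0 _) (gD x).
case: (leP (f x)) => _; first by rewrite (le_trans (gD x))// lerDr.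
by rewrite (le_trans (fC x))// lerDl.
Qed.

Lemma bmeas_sum (J : Type) (r : seq J) (P : pred J) (f : J -> X -> R) :
  (forall j, P j -> bmeas (f j)) -> bmeas (fun x => \sum_(j <- r | P j) f j x).
Proof.
move=> bf; elim: r => [|j r IHr].
  rewrite (_ : (fun x => _) = fun=> 0); first exact: bmeas_cst.
  by apply/funext => x; rewrite big_nil.
rewrite (_ : (fun x => _) = fun x => (if P j then f j x else 0) +
    \sum_(j <- r | P j) f j x); last first.
  by apply/funext => x; rewrite big_cons; case: (P j); rewrite ?add0r.
by apply: bmeasD => //; case Pj: (P j); [exact: bf|exact: bmeas_cst].
Qed.

Lemma bmeas_bigmax (J : Type) (r : seq J) (P : pred J) f0 (f : J -> X -> R) :
  bmeas f0 -> (forall j, bmeas (f j)) ->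
  bmeas (fun x => \big[Num.max/f0 x]_(j <- r | P j) f j x).
Proof.
move=> bf0 bf; elim: r => [|j r IHr].
  by rewrite (_ : (fun x => _) = f0)//; apply/funext => x; rewrite big_nil.
rewrite (_ : (fun x => _) = fun x => if P j
    then Num.max (f j x) (\big[Num.max/f0 x]_(j <- r | P j) f j x)
    else \big[Num.max/f0 x]_(j <- r | P j) f j x); last first.
  by apply/funext => x; rewrite big_cons.
by case: (P j) => //; exact: bmeas_max.
Qed.

Lemma bmeas_expR f : bmeas f -> bmeas (fun x => expR (f x)).
Proof.
move=> [mf [C fC]]; split; first exact: measurableT_comp.
exists (expR C) => x; rewrite ger0_norm ?expR_ge0// ler_expR.
exact: le_trans (ler_norm _) (fC x).
Qed.

Lemma bmeas_ln f delta : bmeas f -> 0 < delta -> (forall x, delta <= f x) ->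
  bmeas (fun x => ln (f x)).
Proof.
move=> [mf [C fC]] delta0 f_ge; split; first exact: measurableT_comp.
exists (Num.max (ln C) (- ln delta)) => x.
have f0 : 0 < f x by apply: lt_le_trans (f_ge x).
have fxC := le_trans (ler_norm _) (fC x).
have l1 : ln (f x) <= ln C by rewrite ler_ln ?posrE// (lt_le_trans f0).
have l2 : ln delta <= ln (f x) by rewrite ler_ln ?posrE.
by rewrite ler_norml lerNl !le_max l1 lerN2 l2 orbT.
Qed.

Lemma bmeas_finite (F : finType) (f : F -> X -> R) (g : X -> F) :
  (forall y, bmeas (f y)) -> (forall y, measurable (g @^-1` [set y])) ->
  bmeas (fun x => f (g x) x).
Proof.
move=> bf mg; split.
  by apply: measurable_fun_fin => // y; case: (bf y).
have /choice[C fC] : forall y, exists C, forall x, `|f y x| <= C.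
  by move=> y; case: (bf y).
exists (\sum_y `|C y|) => x; rewrite (bigD1 (g x))//=.
by rewrite (le_trans (fC _ x))// (le_trans (ler_norm _))// lerDl sumr_ge0.
Qed.

End BoundedMeasurable.

Lemma bmeas_comp d d' (X : measurableType d) (Y : measurableType d')
    (R : realType) (f : Y -> R) (g : X -> Y) :
  bmeas f -> measurable_fun setT g -> bmeas (fun x => f (g x)).
Proof.
move=> [mf [C fC]] mg; split; first exact: measurableT_comp.
by exists C => x.
Qed.

Section Expectation.
Context d (X : measurableType d) (R : realType) (P : probability X R).
Implicit Types f g : X -> R.

Lemma bmeas_integrable f : bmeas f -> P.-integrable setT (EFin \o f).
Proof.
move=> [mf [C fC]]; apply: measurable_bounded_integrable => //.
  by rewrite (le_lt_trans (probability_le1 _ _)) ?ltry.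
by exists C; split; [exact: num_real|move=> D CD x _; exact: le_trans (fC x) (ltW CD)].
Qed.

Lemma mean_cst (c : R) : (\int[P]_x c)%R = c.
Proof.
by rewrite Rintegral_cst// -[RHS]mulr1; have /= -> := congr1 fine (probability_setT P).
Qed.

Lemma meanD f g : bmeas f -> bmeas g ->
  (\int[P]_x (f x + g x) = \int[P]_x f x + \int[P]_x g x)%R.
Proof. by move=> bf bg; rewrite RintegralD//; exact: bmeas_integrable. Qed.

Lemma meanB f g : bmeas f -> bmeas g ->
  (\int[P]_x (f x - g x) = \int[P]_x f x - \int[P]_x g x)%R.
Proof. by move=> bf bg; rewrite RintegralB//; exact: bmeas_integrable. Qed.

Lemma meanZ (c : R) f : bmeas f -> (\int[P]_x (c * f x) = c * \int[P]_x f x)%R.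
Proof. by move=> bf; rewrite RintegralZl//; exact: bmeas_integrable. Qed.

Lemma mean_le f g : bmeas f -> bmeas g -> (forall x, f x <= g x) ->
  (\int[P]_x f x <= \int[P]_x g x)%R.
Proof. by move=> bf bg fg; apply: le_Rintegral => //; exact: bmeas_integrable. Qed.

(** The premise is limited to indices in [r] because boundedness is available only for stages within
    the horizon. *)
Lemma mean_sum (J : eqType) (r : seq J) (f : J -> X -> R) :
  (forall j, j \in r -> bmeas (f j)) ->
  (\int[P]_x \sum_(j <- r) f j x = \sum_(j <- r) \int[P]_x f j x)%R.
Proof.
elim: r => [|j r IHr] bf.
  rewrite big_nil -[RHS]mean_cst; apply: eq_Rintegral => x _.
  by rewrite big_nil.
have br : bmeas (fun x => \sum_(j <- r) f j x).
  rewrite (_ : (fun x => _) = (fun x => \sum_(j <- r | j \in r) f j x)).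
    by apply: bmeas_sum => k kr; apply: bf; rewrite inE kr orbT.
  by apply/funext => x; exact: big_seq.
rewrite big_cons -IHr => [|k kr]; last by apply: bf; rewrite inE kr orbT.
rewrite -meanD//; last by apply: bf; rewrite mem_head.
by apply: eq_Rintegral => x _; rewrite big_cons.
Qed.

Lemma expectation_Rintegral f : fine 'E_P[f] = (\int[P]_x f x)%R.
Proof. by rewrite unlock. Qed.

End Expectation.

(** * Conditioning the trajectory law on the past *)

Section LawFacts.
Variables (R : realType) (I : choiceType) (G : open_system I).
Context d (S : measurableType d).
Variables (M : open_mdp R G S) (pi : policy_seq R G S).
Local Notation mean n f := (\int[law M pi n]_h f h)%R.
Local Notation prob n h a := (joint_prob M (pol pi h) (@state I G d S n h) a).

Let drawn n (a : jact G n.+1) : set (hist G S n.+1) := [set tau | tau.2.1 = a].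

Let measurable_drawn n (a : jact G n.+1) : measurable (drawn a).
Proof.
rewrite -[X in measurable X]setTI.
exact: (measurableT_comp measurable_fst measurable_snd) measurableT [set a] _.
Qed.

(** On the event that [a] is drawn, the past has density [joint_prob] with respect to [law n]: one
    summand of [extend_law] survives and the transition kernel has mass 1. *)
Let law_drawn n (a : jact G n.+1) (A : set (hist G S n)) : measurable A ->
  law M pi n.+1 (drawn a `&` fst @^-1` A) = (\int[law M pi n]_(h in A) (prob n h a)%:E)%E.
Proof.
move=> mA; rewrite /= /extend_law [RHS]integral_mkcond; apply: eq_integral => h _.
rewrite (bigD1 a)//= big1 ?adde0 => [|a' ne].
  rewrite patchE; case: ifPn => hA.
    rewrite (_ : [set _ | _] = setT) ?prob_kernel ?mule1//.
    by apply/seteqP; split=> // s _; split=> //; exact: set_mem.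
  rewrite (_ : [set _ | _] = set0) ?measure0 ?mule0//.
  by apply/seteqP; split=> // s [_ /mem_set]; rewrite (negbTE hA).
rewrite (_ : [set _ | _] = set0) ?measure0 ?mule0//.
by apply/seteqP; split=> // s [e _]; have {}e : a' = a by []; rewrite e eqxx in ne.
Qed.

Lemma bmeas_prob n (a : jact G n.+1) : bmeas (fun h => prob n h a).
Proof.
split; first exact: measurable_joint_prob.
exists 1 => h; rewrite ger0_norm ?joint_prob_ge0// -(sum_joint_prob M pi h).
by rewrite (bigD1 a)//= lerDl sumr_ge0// => a' _; exact: joint_prob_ge0.
Qed.

Lemma bmeas_stage n (f : jact G n.+1 -> hist G S n -> R) :
  (forall a, bmeas (f a)) -> bmeas (fun tau : hist G S n.+1 => f tau.2.1 tau.1).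
Proof.
move=> bf; apply: (bmeas_finite (f := fun a (tau : hist G S n.+1) => f a tau.1)
  (g := fun tau => tau.2.1)) => a; last exact: measurable_drawn.
by apply: (bmeas_comp (bf a)); exact: measurable_fst.
Qed.

Let ge0_mean_stage n (f : jact G n.+1 -> hist G S n -> R) :
  (forall a, bmeas (f a)) -> (forall a h, 0 <= f a h) ->
  mean n.+1 (fun tau => f tau.2.1 tau.1) =
  mean n (fun h => \sum_a prob n h a * f a h).
Proof.
move=> bf f0; congr fine.
transitivity (\int[law M pi n.+1]_tau
    \sum_a ((fun tau : hist G S n.+1 => (f a tau.1)%:E) \_ (drawn a)) tau)%E.
  apply: eq_integral => tau _.
  rewrite (bigD1 tau.2.1)//= big1 ?adde0 => [|a ne].
    by rewrite patchE mem_set.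
  by rewrite patchE memNset// => /esym/eqP; rewrite (negbTE ne).
rewrite ge0_integral_sum//; last 2 first.
- move=> a; apply/(measurable_restrictT _ (measurable_drawn a)).
  apply: measurable_funTS; apply/measurable_EFinP.
  by apply: measurableT_comp => //; case: (bf a).
- by move=> a tau _; rewrite erestrict_ge0// => x _; rewrite lee_fin.
under [RHS]eq_integral do rewrite -sumEFin.
rewrite ge0_integral_sum//; last 2 first.
- by move=> a; apply/measurable_EFinP; case: (bmeasM (bmeas_prob a) (bf a)).
- by move=> a h _; rewrite lee_fin mulr_ge0// joint_prob_ge0.
apply: eq_bigr => a _; rewrite -integral_mkcond.
apply: (ge0_integral_density (p := fun h => prob n h a)) => //.
- exact: measurable_joint_prob.
- by move=> h; exact: joint_prob_ge0.
- by move=> A; exact: law_drawn.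
- by case: (bf a).
Qed.

(** Tower property: the drawn action is averaged given the history. A signed [f] becomes nonnegative
    on adding [|C a|], a constant for each action, which is subtracted again at the end. *)
Lemma mean_stage n (f : jact G n.+1 -> hist G S n -> R) :
  (forall a, bmeas (f a)) ->
  mean n.+1 (fun tau => f tau.2.1 tau.1) =
  mean n (fun h => \sum_a prob n h a * f a h).
Proof.
move=> bf; have /choice[C fC] : forall a, exists C, forall h, `|f a h| <= C.
  by move=> a; case: (bf a).
pose g a h := f a h + `|C a|.
have bg a : bmeas (g a) by apply: bmeasD => //; exact: bmeas_cst.
have g0 a h : 0 <= g a h.
  rewrite /g -lerBlDr sub0r; apply: le_trans (_ : - `|f a h| <= _); last first.
    by rewrite lerNl -normrN ler_norm.
  by rewrite lerN2 (le_trans (fC a h))// ler_norm.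
have bC a : bmeas ((fun a (_ : hist G S n) => `|C a|) a) by exact: bmeas_cst.
have bgM a : bmeas (fun h => prob n h a * g a h).
  by apply: bmeasM => //; exact: bmeas_prob.
have bCM a : bmeas (fun h => prob n h a * `|C a|).
  by apply: bmeasM => //; exact: bmeas_prob.
transitivity (mean n.+1 (fun tau => g tau.2.1 tau.1) -
    mean n.+1 (fun tau => `|C tau.2.1|)).
  rewrite -meanB; [|exact: (bmeas_stage bg)|exact: (bmeas_stage bC)].
  by apply: eq_Rintegral => tau _; rewrite /g addrK.
rewrite (ge0_mean_stage bg g0) (ge0_mean_stage bC)//= -meanB.
- apply: eq_Rintegral => h _; rewrite -sumrB; apply: eq_bigr => a _.
  by rewrite -mulrBr /g addrK.
- by apply: bmeas_sum => a _; exact: bgM.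
- by apply: bmeas_sum => a _; exact: bCM.
Qed.

Lemma mean_past n (f : hist G S n -> R) : bmeas f ->
  mean n.+1 (fun tau => f tau.1) = mean n f.
Proof.
move=> bf; rewrite (mean_stage (f := fun=> f))//.
by apply: eq_Rintegral => h _; rewrite -mulr_suml sum_joint_prob mul1r.
Qed.

Lemma bmeas_at_stage (f : forall k, hist G S k -> jact G k.+1 -> S -> R) k n :
  bmeas (fun tau : hist G S k.+1 => f k tau.1 tau.2.1 tau.2.2) ->
  bmeas (@at_stage R I G d S f k.+1 n).
Proof.
move=> bf; elim: n => [|n IHn] /=; first exact: bmeas_cst.
case: eqP => [[kn]|_]; first by subst n.
by apply: (bmeas_comp IHn); exact: measurable_fst.
Qed.

(** Lengthening the horizon beyond stage [k.+1] leaves the mean unchanged, since the longer law has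
    the shorter one as marginal. *)
Lemma mean_at_stage (f : forall k, hist G S k -> jact G k.+1 -> S -> R) k n :
  (k < n)%N -> bmeas (fun tau : hist G S k.+1 => f k tau.1 tau.2.1 tau.2.2) ->
  mean n (fun tau => at_stage f k.+1 tau) =
  mean k.+1 (fun tau => f k tau.1 tau.2.1 tau.2.2).
Proof.
move=> + bf; elim: n => // n IHn; rewrite ltnS leq_eqVlt.
have [e _|ne /= kn] := eqVneq k n.
  by subst n; apply: eq_Rintegral => tau _ /=; rewrite eqxx.
rewrite -IHn// -mean_past; last exact: bmeas_at_stage.
by apply: eq_Rintegral => tau _ /=; rewrite eqSS (negbTE ne).
Qed.

(** The range [m] is separate from the horizon [n] because the tracking variation stops one stage
    before the end. Stage [t] corresponds to [k = t - 1]. *)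
Lemma mean_sum_at_stage (f : forall k, hist G S k -> jact G k.+1 -> S -> R) m n :
  (m <= n)%N ->
  (forall k, (k < m)%N ->
    bmeas (fun tau : hist G S k.+1 => f k tau.1 tau.2.1 tau.2.2)) ->
  fine 'E_(law M pi n)[fun tau => \sum_(1 <= t < m.+1) at_stage f t tau] =
  \sum_(k < m) mean k.+1 (fun tau => f k tau.1 tau.2.1 tau.2.2).
Proof.
move=> mn bf; rewrite expectation_Rintegral mean_sum => [|t].
  rewrite big_add1/= big_mkord; apply: eq_bigr => k _.
  by rewrite mean_at_stage ?(leq_trans _ mn)//; exact: bf.
rewrite mem_index_iota; case: t => // k /andP[_ km].
by apply: bmeas_at_stage; exact: bf.
Qed.

End LawFacts.

(** * Telescoping along the trajectory *)

Section KLBounded.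
Context d (X : measurableType d) (R : realType) (A : finType).
Implicit Types p theta : A -> X -> R.

(** The bound 1 comes from [ln (1 / f) <= 1 / f - 1] where [f > 0]; at [f = 0] the product is 0. *)
Lemma bmeas_mul_ln (f : X -> R) : measurable_fun setT f ->
  (forall x, 0 <= f x <= 1) -> bmeas (fun x => f x * ln (f x)).
Proof.
move=> mf f01; split; first by apply: measurable_funM => //; exact: measurableT_comp.
exists 1 => x; have /andP[] := f01 x.
rewrite le_eqVlt => /predU1P[<- _|f0 f1]; first by rewrite mul0r normr0.
rewrite ler0_norm; last by rewrite pmulr_rle0// ln_le0.
rewrite -mulrN -lnV ?posrE// (@le_trans _ _ (f x * ((f x)^-1 - 1)))//.
  rewrite ler_pM2l//; have := @le_ln1Dx _ ((f x)^-1 - 1).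
  rewrite [1 + _]addrC subrK; apply.
  by rewrite ltrBrDl subrr invr_gt0.
by rewrite mulrBr mulfV ?gt_eqF// mulr1 gerBl ltW.
Qed.

Lemma bmeas_ln_sum_expR theta (b : A) : (forall b, bmeas (theta b)) ->
  bmeas (fun x => ln (\sum_c expR (theta c x))).
Proof.
move=> btheta; have [_ [C thetaC]] := btheta b.
apply: (@bmeas_ln _ _ _ _ (expR (- C))); last 2 first.
- exact: expR_gt0.
- move=> x; rewrite (bigD1 b)//= (@le_trans _ _ (expR (theta b x)))//.
    by rewrite ler_expR lerNl (le_trans _ (thetaC x))// -normrN ler_norm.
  by rewrite lerDl sumr_ge0// => c _; exact: expR_ge0.
by apply: bmeas_sum => c _; exact: bmeas_expR.
Qed.

Lemma ln_gibbs (u : A -> R) b : ln (gibbs u b) = u b - ln (\sum_c expR (u c)).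
Proof. by rewrite /gibbs ln_div ?posrE ?expR_gt0 ?(sum_expR_gt0 _ b)// expRK. Qed.

Lemma bmeas_gibbs theta b : (forall b, bmeas (theta b)) ->
  bmeas (fun x => gibbs (theta ^~ x) b).
Proof.
move=> btheta.
rewrite (_ : (fun x => _) =
    (fun x => expR (theta b x - ln (\sum_c expR (theta c x))))).
  by apply: bmeas_expR; apply: bmeasB => //; exact: (bmeas_ln_sum_expR b).
by apply/funext => x; rewrite -(ln_gibbs (theta ^~ x)) lnK// posrE gibbs_gt0.
Qed.

(** The first argument may vanish, so its entropy goes through [bmeas_mul_ln]; the logarithm of the
    second is bounded because its logits are. *)
Lemma bmeas_KL p theta :
  (forall b, measurable_fun setT (p b)) -> (forall b x, 0 <= p b x <= 1) ->
  (forall b, bmeas (theta b)) ->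
  bmeas (fun x => KL (p ^~ x) (gibbs (theta ^~ x))).
Proof.
move=> mp p01 btheta; rewrite (_ : (fun x => _) = (fun x => \sum_b
    (p b x * ln (p b x) - p b x * (theta b x - ln (\sum_c expR (theta c x)))))).
  apply: bmeas_sum => b _; apply: bmeasB; first exact: bmeas_mul_ln.
  apply: bmeasM; last by apply: bmeasB => //; exact: (bmeas_ln_sum_expR b).
  by split => //; exists 1 => x; have /andP[? ?] := p01 b x; rewrite ger0_norm.
apply/funext => x; rewrite KLE => [|b|b]; last 2 first.
- by case/andP: (p01 b x).
- exact: gibbs_gt0.
by apply: eq_bigr => b _; rewrite (ln_gibbs (theta ^~ x)).
Qed.

End KLBounded.

(** * Divergences and utilities along a run of the algorithm *)

Section Algorithm.
Variables (R : realType) (I : choiceType) (G : open_system I).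
Context d (S : measurableType d).
Variables (M : open_mdp R G S) (T : nat).
Variables (theta0 : forall i : I, obs G i -> act G i -> R) (eta B : R).
Variable xstar : forall t : nat, S -> slot G t -> R.
Hypothesis eta0 : 0 < eta.
Hypothesis util_prop : forall (t : nat) (s : S), (1 <= t <= T)%N ->
    [/\ set_normalized (util M t s), set_monotone (util M t s)
      & set_submodular (util M t s)].
Hypothesis util_gain : forall (t : nat) (s : S) (A : {set slot G t}) (e : slot G t),
    (1 <= t <= T)%N -> e \notin A -> 0 <= gain (util M t s) A e <= B.
Hypothesis xstar_max : forall (t : nat) (s : S), (1 <= t <= T)%N ->
    stage_maximizer M s (@xstar t s).
Hypothesis xstar_meas : forall (t : nat) (e : slot G t), (1 <= t <= T)%N ->
    measurable_fun setT (fun s : S => @xstar t s e).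

Local Notation theta := (logits M theta0 eta).
Local Notation alg := (submapl M theta0 eta).
Local Notation mean n f := (\int[law M alg n]_h f h)%R.

Lemma bmeas_util k A : (k < T)%N -> bmeas (fun s => util M k.+1 s A).
Proof.
move=> kT; split; first exact: measurable_util.
exists (#|A|%:R * B) => s; rewrite ger0_norm ?util_ge0//.
have [F0 Fmono Fsub] := @util_prop k.+1 s kT.
apply: le_card_gain => // e.
by case/andP: (@util_gain k.+1 s finset.set0 e kT (negbT (finset.in_set0 e))).
Qed.

Lemma bmeas_observed d' (X : measurableType d') t (i : active G t)
    (f : obs G (val i) -> X -> R) (g : X -> S) :
  (forall o, bmeas (f o)) -> measurable_fun setT g ->
  bmeas (fun x => f (observe M i (g x)) x).
Proof.
move=> bf mg; apply: (bmeas_finite (g := observe M i \o g)) => // o.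
rewrite comp_preimage -[X in measurable X]setTI.
by apply: mg => //; exact: measurable_observe.
Qed.

Lemma bmeas_gain_hat k (a : jact G k.+1) (i : active G k.+1) b :
  (k < T)%N -> bmeas (fun s => gain_hat M s a (i := i) b).
Proof. by move=> kT; apply: bmeasB; exact: bmeas_util. Qed.

Lemma bmeas_update d' (X : measurableType d') k (g : X -> S) a
    (u : X -> tabular R G k.+1) (i : active G k.+1) o b : (k < T)%N ->
  measurable_fun setT g -> (forall i o b, bmeas (fun x => u x i o b)) ->
  bmeas (fun x => update M eta (g x) a (u x) (i := i) o b).
Proof.
move=> kT mg bu; apply: (bmeas_observed (i := i) (g := g) (f := fun o' x =>
  if o == o' then u x i o b + eta * gain_hat M (g x) a (i := i) b
  else u x i o b)) => // o'.
case: (o == o') => //; apply: bmeasD => //; apply: bmeasM; first exact: bmeas_cst.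
by apply: (bmeas_comp (f := fun s => gain_hat M s a (i := i) b)) => //;
  exact: bmeas_gain_hat.
Qed.

(** By induction: each stage adds a bounded gain to the logits of a staying agent, and an entering
    agent starts from constants. *)
Lemma bmeas_logits n (i : active G n.+1) o b : (n <= T)%N ->
  bmeas (fun h : hist G S n => theta h (i := i) o b).
Proof.
elim: n i o b => [|n IHn] i o b nT /=; first exact: bmeas_cst.
rewrite /migrate; destruct (@idP (val i \in active G n.+1)) as [act_i|_];
  last exact: bmeas_cst.
apply: (bmeas_stage (f := fun a h => update M eta (state h) a (theta h)
  (i := [` act_i]%fset) o b)) => a.
apply: (@bmeas_update _ (hist G S _) _ (@state _ _ _ _ _) _ (fun h => theta h)) => //;
  first exact: measurable_state.
by move=> *; exact/IHn/ltnW.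
Qed.

Lemma xstar_bounds k s (e : slot G k.+1) : (k < T)%N -> 0 <= xstar s e <= 1.
Proof. by move=> kT; case: (@xstar_max k.+1 s kT) => -[x01 _] _; exact: x01. Qed.

Lemma softmax_bounds t (u : tabular R G t) (i : active G t) o b :
  0 <= softmax u i o b <= 1.
Proof.
have [p0 p1] := @softmaxP _ _ _ _ u i o; rewrite p0/= -p1.
by rewrite (bigD1 b)//= lerDl sumr_ge0.
Qed.

Lemma bmeas_KLtab d' (X : measurableType d') k (g : X -> S)
    (u v : X -> tabular R G k.+1) : (k < T)%N -> measurable_fun setT g ->
  (forall i o b, bmeas (fun x => u x i o b)) ->
  (forall i o b, bmeas (fun x => v x i o b)) ->
  bmeas (fun x => KLtab (star M xstar (g x) (softmax (u x))) (softmax (v x))).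
Proof.
move=> kT mg bu bv; apply: bmeas_sum => i _; apply: bmeas_sum => o _.
apply: (bmeas_KL (p := fun b x =>
    star M xstar (g x) (softmax (u x)) (i := i) o b)
  (theta := fun b x => v x i o b)) => [b|b x|b]; last exact: bv.
- apply: (measurable_observed M (i := i) (g := g) (f := fun o' x =>
    if o == o' then xstar (g x) (mkslot b) else softmax (u x) i o b)) => // o'.
  case: (o == o').
    exact: (measurableT_comp (@xstar_meas k.+1 (mkslot b) kT) mg).
  by have [] // := @bmeas_gibbs _ _ _ _ (fun b x => u x i o b) b.
- rewrite /star; case: ifPn => _; last exact: softmax_bounds.
  exact: xstar_bounds.
Qed.

(** With [t = k + 1], [KLpre] is the divergence of the comparator from [pi_t], and [KLpost] its
    divergence from the updated [pi_t^+]. *)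
Definition KLpre k (h : hist G S k) : R :=
  KLtab (star M xstar (state h) (softmax (theta h))) (softmax (theta h)).

Definition KLpost k (a : jact G k.+1) (h : hist G S k) : R :=
  KLtab (star M xstar (state h) (softmax (theta h)))
    (softmax (update M eta (state h) a (theta h))).

Lemma bmeas_KLpre k : (k < T)%N -> bmeas (@KLpre k).
Proof.
move=> kT; apply: (@bmeas_KLtab _ (hist G S k) k (@state _ _ _ _ k) (fun h => theta h)
  (fun h => theta h)) => //.
- exact: measurable_state.
- by move=> *; exact/bmeas_logits/ltnW.
- by move=> *; exact/bmeas_logits/ltnW.
Qed.

Lemma bmeas_KLpost k a : (k < T)%N -> bmeas (@KLpost k a).
Proof.
move=> kT; apply: (@bmeas_KLtab _ (hist G S k) k (@state _ _ _ _ k) (fun h => theta h)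
  (fun h => update M eta (state h) a (theta h))) => //.
- exact: measurable_state.
- by move=> *; exact/bmeas_logits/ltnW.
- move=> *; apply: (@bmeas_update _ (hist G S _) _ (@state _ _ _ _ _) _ (fun h => theta h)) => //.
    exact: measurable_state.
  by move=> *; exact/bmeas_logits/ltnW.
Qed.

Lemma bmeas_Fstar k : (k < T)%N ->
  bmeas (fun h : hist G S k => Fstar M k.+1 (state h)).
Proof.
move=> kT; apply: (@bmeas_comp _ _ _ _ _ (Fstar M k.+1)); last exact: measurable_state.
by apply: bmeas_bigmax => [|A]; exact: bmeas_util.
Qed.

Lemma bmeas_reward k (a : jact G k.+1) : (k < T)%N ->
  bmeas (fun h : hist G S k => util M k.+1 (state h) (executed a)).
Proof.
move=> kT; apply: (@bmeas_comp _ _ _ _ _ (fun s => util M k.+1 s (executed a))).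
  exact: bmeas_util.
exact: measurable_state.
Qed.

Lemma KLpost_ge0 k a (h : hist G S k) : (k < T)%N -> 0 <= KLpost a h.
Proof.
move=> kT; apply: sumr_ge0 => i _; apply: sumr_ge0 => o _.
have [x01 x1] := (@xstar_max k.+1 (state h) kT).1.
have [p0 p1] := @softmaxP _ _ _ _ (theta h) i o.
apply: KL_ge0.
- move=> b; rewrite /star; case: ifPn => // _.
  by case/andP: (x01 (mkslot b)).
- rewrite -p1 /star; have [oE|_] := eqVneq o (observe M i (state h)) => //.
  by rewrite p1 x1.
- move=> b; exact: gibbs_gt0.
- by have [] := @softmaxP _ _ _ _ (update M eta (state h) a (theta h)) i o.
Qed.

Lemma card_agents k : (k < T)%N -> (#|{: active G k.+1}| <= Nmax G T)%N.
Proof.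
move=> kT; rewrite -cardfE /Nmax.
by apply: (@leq_bigmax_seq _ _ predT (fun t => #|` active G t|)) => //;
  rewrite mem_index_iota ltnS.
Qed.

(** Most means are taken over [hist k.+1], the form given by [mean_sum_at_stage]. [mean_KLpre] lives
    on [hist k], so that at [k.+1] it shares its space with [mean_KLpost k]. *)
Definition mean_Fstar k :=
  mean k.+1 (fun tau : hist G S k.+1 => Fstar M k.+1 (state tau.1)).
Definition mean_reward k := mean k.+1 (fun tau : hist G S k.+1 =>
  reward M tau.1 tau.2.1 tau.2.2).
Definition mean_KLpre k := mean k (@KLpre k).
Definition mean_KLpost k := mean k.+1 (fun tau => @KLpost k tau.2.1 tau.1).
Definition mean_drift k := mean k.+1 (fun tau : hist G S k.+1 =>
  drift M theta0 eta xstar tau.1 tau.2.1 tau.2.2).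

(** Once [mean_stage] has averaged the action given the history, [stage_inequality] applies history
    by history; the number of agents is then bounded by [Nmax]. *)
Lemma mean_stage_inequality k : (k < T)%N ->
  eta * (mean_Fstar k - 2 * mean_reward k) <=
  mean_KLpre k - mean_KLpost k + (Nmax G T)%:R * ((eta * B) ^+ 2 / 2).
Proof.
move=> kT; set c := _ * (_ / 2).
have bF := bmeas_Fstar kT; have bR a := bmeas_reward a kT.
have bD := bmeas_KLpre kT; have bP a := bmeas_KLpost a kT.
pose lhs a (h : hist G S k) :=
  eta * (Fstar M k.+1 (state h) - 2 * util M k.+1 (state h) (executed a)).
pose rhs a (h : hist G S k) := KLpre h - KLpost a h + c.
have b2R a : bmeas (fun h : hist G S k => 2 * util M k.+1 (state h) (executed a)).
  by apply: bmeasM => //; exact: bmeas_cst.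
have blhs a : bmeas (lhs a).
  by apply: bmeasM; [exact: bmeas_cst|apply: bmeasB].
have brhs a : bmeas (rhs a).
  by apply: bmeasD; [apply: bmeasB|exact: bmeas_cst].
have le_mean : mean k.+1 (fun tau => lhs tau.2.1 tau.1) <=
    mean k.+1 (fun tau => rhs tau.2.1 tau.1).
  rewrite (mean_stage M alg blhs) (mean_stage M alg brhs).
  have bw a := bmeas_prob M alg a.
  apply: mean_le.
  - by apply: bmeas_sum => a _; apply: bmeasM => //; exact: bw.
  - by apply: bmeas_sum => a _; apply: bmeasM => //; exact: bw.
  move=> h; have [F0 Fmono Fsub] := @util_prop k.+1 (state h) kT.
  apply: le_trans (stage_inequality F0 Fmono Fsub _ (theta h) _ eta0) _.
  - by move=> A e; exact: util_gain.
  - exact: xstar_max.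
  - apply: ler_sum => a _; rewrite ler_wpM2l ?(joint_prob_ge0 M alg h)//.
    rewrite /rhs lerD2l /c ler_wpM2r ?ler_nat ?card_agents//.
    by rewrite divr_ge0 ?sqr_ge0.
have past (f : hist G S k -> R) : bmeas f -> bmeas (fun tau : hist G S k.+1 => f tau.1).
  by move=> bf; apply: (bmeas_stage (f := fun=> f)).
have bF' := past _ bF; have bD' := past _ bD.
have bR' := bmeas_stage bR; have b2R' := bmeas_stage b2R.
have bP' := bmeas_stage bP.
have lhsE : mean k.+1 (fun tau => lhs tau.2.1 tau.1) =
    eta * (mean_Fstar k - 2 * mean_reward k).
  have := meanZ (law M alg k.+1) eta (bmeasB bF' b2R').
  by rewrite (meanB _ bF' b2R') (meanZ _ 2 bR').
have rhsE : mean k.+1 (fun tau => rhs tau.2.1 tau.1) =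
    mean_KLpre k - mean_KLpost k + c.
  have := meanD (law M alg k.+1) (bmeasB bD' bP') (bmeas_cst _ c).
  by rewrite (meanB _ bD' bP') mean_cst (mean_past M alg bD).
by rewrite -lhsE -rhsE.
Qed.

Lemma bmeas_drift k : (k.+1 < T)%N -> bmeas (fun tau : hist G S k.+1 =>
  drift M theta0 eta xstar tau.1 tau.2.1 tau.2.2).
Proof.
(* The next policy in [drift] is the one in force after the extended history [tau], so its
   divergence is [KLpre tau]. *)
move=> kT; rewrite (_ : (fun tau => _) = (fun tau : hist G S k.+1 =>
    Num.max (KLpre tau - KLpost tau.2.1 tau.1) 0)); last first.
  by apply/funext => -[h [a s']].
apply: bmeas_max; last exact: bmeas_cst.
apply: bmeasB; first exact: bmeas_KLpre.
by apply: (bmeas_stage (f := fun a h => KLpost a h)) => a; exact/bmeas_KLpost/ltnW.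
Qed.

Lemma mean_drift_ge k : (k.+1 < T)%N ->
  mean_KLpre k.+1 - mean_KLpost k <= mean_drift k.
Proof.
move=> kT; have bD := bmeas_KLpre kT.
have bP : bmeas (fun tau : hist G S k.+1 => KLpost tau.2.1 tau.1).
  by apply: (bmeas_stage (f := fun a h => KLpost a h)) => a; exact/bmeas_KLpost/ltnW.
rewrite /mean_KLpre /mean_KLpost -meanB//; apply: mean_le.
- exact: bmeasB.
- exact: bmeas_drift.
- by move=> -[h [a s']]; rewrite le_max lexx.
Qed.

End Algorithm.

(** * Summation over the stages *)

Theorem theorem1 (R : realType) (I : choiceType) (G : open_system I)
    (d : measure_display) (S : measurableType d) (M : open_mdp R G S)
    (T : nat) (theta0 : forall i : I, obs G i -> act G i -> R) (eta B : R)
    (xstar : forall t : nat, S -> slot G t -> R) :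
  (0 < T)%N ->
  0 < eta ->
  (forall (t : nat) (s : S), (1 <= t <= T)%N ->
    [/\ set_normalized (util M t s), set_monotone (util M t s)
      & set_submodular (util M t s)]) ->
  (forall (t : nat) (s : S) (A : {set slot G t}) (e : slot G t),
    (1 <= t <= T)%N -> e \notin A -> 0 <= gain (util M t s) A e <= B) ->
  (forall (t : nat) (s : S), (1 <= t <= T)%N ->
    stage_maximizer M s (xstar t s)) ->
  (forall (t : nat) (e : slot G t), (1 <= t <= T)%N ->
    measurable_fun setT (fun s : S => xstar t s e)) ->
  2^-1 * Jstar M T - J M T (submapl M theta0 eta) <=
    (initial_KL M theta0 xstar + Vopen M theta0 eta xstar T) / (2 * eta)
    + eta * T%:R * (Nmax G T)%:R * B ^+ 2 / 4
    + 2^-1 * DeltaT M theta0 eta T.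
Proof.
move=> T_gt0 eta0 util_prop util_gain xstar_max xstar_meas.
pose pre := mean_KLpre M theta0 eta xstar.
pose post := mean_KLpost M theta0 eta xstar.
pose v := mean_drift M theta0 eta xstar.
pose f := mean_Fstar M theta0 eta; pose r := mean_reward M theta0 eta.
pose c := (Nmax G T)%:R * ((eta * B) ^+ 2 / 2).
have JE : J M T (submapl M theta0 eta) = \sum_(k < T) r k.
  rewrite /J (mean_sum_at_stage _ _ (leqnn T))// => k kT.
  apply: (bmeas_stage (f := fun a h => reward M h a (state h))) => a.
  exact (bmeas_reward util_prop util_gain a kT).
have FE : fine 'E_(law M (submapl M theta0 eta) T)[fun tau =>
    \sum_(1 <= t < T.+1) at_stage (fun k h _ _ => Fstar M k.+1 (state h)) t tau] =
    \sum_(k < T) f k.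
  rewrite (mean_sum_at_stage _ _ (leqnn T))// => k kT.
  apply: (bmeas_stage (f := fun _ h => Fstar M k.+1 (state h))) => _.
  exact (bmeas_Fstar util_prop util_gain kT).
(* There are [T - 1] jumps between consecutive stages; [0 < T] makes [T.-1.+1] equal to [T]. *)
have VE : Vopen M theta0 eta xstar T = \sum_(k < T.-1) v k.
  have := @mean_sum_at_stage _ _ _ _ _ M (submapl M theta0 eta)
    (drift M theta0 eta xstar) T.-1 T (leq_pred T).
  rewrite (prednK T_gt0); apply => k kT.
  apply: (bmeas_drift theta0 eta util_prop util_gain xstar_max xstar_meas).
  by rewrite -(prednK T_gt0) ltnS.
have preE : initial_KL M theta0 xstar = pre 0%N.
  by rewrite /initial_KL expectation_Rintegral.
(* Regrouping pairs [pre k.+1] with [post k], and each such jump is at most [v k]. *)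
have telescope n : (n < T)%N ->
    \sum_(k < n.+1) (pre k - post k) <= pre 0%N + \sum_(k < n) v k - post n.
  elim: n => [|n IHn] nT; first by rewrite big_ord_recr !big_ord0/= add0r addr0.
  rewrite big_ord_recr [in leRHS]big_ord_recr/=.
  have : pre n.+1 - post n <= v n.
    exact: (mean_drift_ge theta0 eta util_prop util_gain xstar_max xstar_meas).
  have := IHn (ltnW nT); lra.
(* Allows the last divergence left by the telescoping to be dropped. *)
have post_ge0 k : (k < T)%N -> 0 <= post k.
  move=> kT; apply: Rintegral_ge0 => tau _.
  exact: (KLpost_ge0 theta0 eta xstar_max).
have regret : eta * (\sum_(k < T) f k - 2 * \sum_(k < T) r k) <=
    pre 0%N + \sum_(k < T.-1) v k + T%:R * c.
  apply: (@le_trans _ _ (\sum_(k < T) (pre k - post k + c))).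
    rewrite mulr_sumr -sumrB mulr_sumr ler_sum// => k _.
    exact: (mean_stage_inequality theta0 eta0 util_prop util_gain xstar_max xstar_meas).
  rewrite big_split/= sumr_const card_ord -[c *+ T]mulr_natl lerD2r.
  have T1 : (T.-1 < T)%N by rewrite prednK.
  have := telescope _ T1; have := post_ge0 _ T1.
  rewrite prednK//; lra.
have DeltaE : Jstar M T - \sum_(k < T) f k <= DeltaT M theta0 eta T.
  by rewrite /DeltaT FE le_max lexx.
rewrite JE VE preE -/pre.
set X := _ + \sum_(k < T.-1) _ in regret *.
(* Division of [regret] by [2 * eta] turns [T * c] into [eta * T * Nmax * B ^ 2 / 4]. The rest is
   the splitting of [Jstar / 2 - sum r] into [(Jstar - sum f) / 2] and [(sum f - 2 * sum r) / 2]. *)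
have : (\sum_(k < T) f k - 2 * \sum_(k < T) r k) / 2 <=
    X / (2 * eta) + eta * T%:R * (Nmax G T)%:R * B ^+ 2 / 4.
  have -> : X / (2 * eta) + eta * T%:R * (Nmax G T)%:R * B ^+ 2 / 4 =
      (X + T%:R * c) / (2 * eta).
    by rewrite /c; field; rewrite gt_eqF.
  rewrite ler_pdivlMr ?mulr_gt0//.
  by rewrite mulrA divfK// mulrC.
by move: DeltaE; lra.
Qed.
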